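(* Let $G$ be a diffeological group, let $H$ be a subgroup of $G$, and let $e$ be the identity element. Then the natural maps $\iota : H \hookrightarrow G$ and $\pi : G \twoheadrightarrow G/H$ induce an exact sequence of real vector spaces $$T_e(H) \xrightarrow{\ \iota_*\ } T_e(G) \xrightarrow{\ \pi_*\ } T_{eH}(G/H) \to 0.$$ Moreover, $T^H_{eH}(G/H) = T^{dvs}_{eH}(G/H)$ as diffeological spaces, and $\pi_* : T_e(G) \to T_{eH}(G/H)$ is a subduction (both as a map $T^H_e(G) \to T^H_{eH}(G/H)$ and as a map $T^{dvs}_e(G) \to T^{dvs}_{eH}(G/H)$).
   Context: A diffeological space is a set $X$ with, for each $n \ge 0$ and each open $U \subseteq \mathbb{R}^n$, a specified set of functions $U \to X$ called plots, such that: every constant function $U\to X$ is a plot; if $U \to X$ is a plot and $V \to U$ is a smooth map between open subsets of Euclidean spaces, the composite $V \to X$ is a plot; and a function $U \to X$ whose restriction to each member of some open cover of $U$ is a plot is itself a plot. A function $f : X \to Y$ is smooth if $f \circ p$ is a plot of $Y$ for every plot $p$ of $X$. Subsets carry the sub-diffeology (plots are the functions whose composite to the ambient space is a plot); products and pullbacks carry the product diffeology and its sub-diffeology; a quotient carries the quotient diffeology, whose plots are the functions that locally lift to plots of the original space. A subduction is a smooth surjection $X \to Y$ such that the plots of $Y$ are exactly the functions $U \to Y$ that locally lift to plots of $X$. A diffeological group is a group with a diffeology for which multiplication and inversion are smooth. For a subgroup $H$ (no closedness assumed), $H$ has the sub-diffeology and $G/H$ is the set of cosets $gH$ with the quotient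 diffeology. A pointed plot $p : (U,0) \to (X,x)$ is a plot $p:U\to X$ where $U$ is a connected open neighbourhood of $0$ in some $\mathbb{R}^n$ and $p(0) = x$. The germ category $\mathcal{G}(X,x)$ has the pointed plots as objects; a morphism from $p : (U,0)\to (X,x)$ to $q : (V,0) \to (X,x)$ is the germ at $0$ of a smooth map $f : W \to V$, with $W$ an open neighbourhood of $0$ in $U$, $f(0)=0$ and $p|_W = q \circ f$. The internal tangent space $T_x(X)$ is the colimit, in real vector spaces, of the functor $\mathcal{G}(X,x) \to \mathrm{Vect}$ sending $p : (U,0) \to (X,x)$ to $T_0(U)$ and a germ $f$ to its derivative at $0$. The class of $u \in T_0(U)$ at $p$ is written $p_*(u)$. A smooth map $f : X \to Y$ induces a linear map $f_* : T_x(X) \to T_{f(x)}(Y)$ with $f_*(p_*(u)) = (f\circ p)_*(u)$. Let $TX = \coprod_{x \in X} T_x(X)$ with projection to $X$. For a plot $p : U \to X$, let $Tp : TU \to TX$ send $v \in T_u U$ to the element of $T_{p(u)}(X)$ represented by $v$ at the pointed plot $w \mapsto p(u+w)$ (defined near $0$). $T^H X$ (Hector's diffeology) is $TX$ with the smallest diffeology making all $Tp$ smooth; its plots are the functions that locally are constant or of the form $Tp \circ f$ with $f : U' \to TU$ smooth. $T^{dvs} X$ is $TX$ with the smallest diffeology containing Hector's diffeology and making $TX$ a diffeological vector space over $X$, i.e. such that the projection to $X$, the fiberwise addition $TX \times_X TX \to TX$ and the scalar multiplication $TX \times \mathbb{R} \to TX$ are smooth. $T_x^H(X)$ and $T_x^{dvs}(X)$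 denote the fiber $T_x(X)$ with the sub-diffeology from $T^H X$ and $T^{dvs}X$ respectively. *)

(* Defs.v *)
From HB Require Import structures.
From mathcomp Require Import all_boot all_order all_algebra.
From mathcomp Require Import generic_quotient.
From mathcomp Require Import all_classical all_reals all_analysis.
Set Implicit Arguments.
Unset Strict Implicit.
Unset Printing Implicit Defensive.
Import Order.TTheory GRing.Theory Num.Theory.
Import numFieldNormedType.Exports.
Local Open Scope classical_set_scope.
Local Open Scope quotient_scope.
Local Open Scope ring_scope.

Section Smooth.
Context {R : realType}.
Implicit Types V W : normedModType R.

(* C^k on an open set U: f is differentiable on U with C^(k-1) directional     *)
(* derivatives. For open U this depends only on the values of f on U, see      *)
(* [Ck_ext]. It is used for finite-dimensional V only.                         *)
Fixpoint Ck V W (k : nat) (U : set V) (f : V -> W) : Prop :=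
  if k is k'.+1 then
    (forall x, U x -> differentiable f x) /\
    (forall v, Ck k' U (fun x => 'D_v f x))
  else forall x, U x -> {for x, continuous f}.

Definition smooth_on V W (U : set V) (f : V -> W) := forall k, Ck k U f.

Lemma near_eq_differentiable V W (f g : V -> W) (x : V) :
  (\near x, f x = g x) -> differentiable f x -> differentiable g x.
Proof.
move=> fg df.
have -> : g = f + (g - f) by apply/funext => y; rewrite !fctE addrC subrK.
apply: differentiableD => //.
set h := g - f.
have h0 : \forall y \near 0 : V, h (y + x) = 0.
  have : \forall y \near x, h y = 0.
    by apply: filterS fg => y e; rewrite /h !fctE e subrr.
  by rewrite (near_shift 0 x); apply: filterS => y; rewrite /= ?subr0.
pose z : {linear V -> W} := (@GRing.null_fun V W).
have E : h \o shift x = cst (h x) + z +o_ (0 : V) id.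
  have hx : h x = 0 by move: (nbhs_singleton h0); rewrite add0r.
  rewrite hx; apply/eqaddoP => _/posnumP[e]; near=> y.
  have hy : h (y + x) = 0 by exact: (near h0 y).
  rewrite !fctE /= hy (_ : 0 - _ = 0) ?normr0 ?mulr_ge0//.
  by rewrite !add0r; exact: oppr0.
have c0 : continuous z by move=> y; exact: cst_continuous.
apply/diff_locallyP; rewrite (diff_unique c0 E); split => //.
Unshelve. all: by end_near. Qed.

Lemma Ck_ext V W k (U : set V) (f g : V -> W) : open U ->
  (forall x, U x -> f x = g x) -> Ck k U f -> Ck k U g.
Proof.
move=> oU; elim: k f g => [|k IH] f g fg /=.
  move=> cf x Ux; rewrite /prop_for /continuous_at -fg//.
  apply: cvg_trans (cf x Ux); apply: near_eq_cvg.
  by apply: filterS (open_nbhs_nbhs (conj oU Ux)) => y /fg.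
move=> [df Df]; split => [x Ux|v].
  apply: near_eq_differentiable (df x Ux).
  by apply: filterS (open_nbhs_nbhs (conj oU Ux)) => y /fg.
apply: IH (Df v) => x Ux; apply: near_eq_derive.
by apply: filterS (open_nbhs_nbhs (conj oU Ux)) => y /fg.
Qed.

Lemma Ck_sub V W k (U U' : set V) (f : V -> W) :
  U' `<=` U -> Ck k U f -> Ck k U' f.
Proof.
move=> UU; elim: k f => [|k IH] f /=; first by move=> cf x /UU /cf.
by move=> [df Df]; split => [x /UU /df//|v]; apply: IH.
Qed.

Lemma Ck_local V W k (U : set V) (f : V -> W) :
  (forall x, U x -> exists2 U', U' x & Ck k U' f) -> Ck k U f.
Proof.
elim: k f => [|k IH] f /= H; first by move=> x /H[U' Ux]; apply.
split=> [x /H[U' Ux [+ _]]|v]; first exact.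
by apply: IH => x /H[U' Ux [_ /(_ v)]]; exists U'.
Qed.

Lemma CkS V W k (U : set V) (f : V -> W) : Ck k.+1 U f -> Ck k U f.
Proof.
elim: k f => [|k IH] f.
  by move=> [df _] x /df; apply: differentiable_continuous.
by move=> [df Df]; split=> // v; apply: IH.
Qed.

Lemma Ck_cst V W k (U : set V) (c : W) : Ck k U (fun=> c).
Proof.
elim: k c => [|k IH] c /=; first by move=> x _; exact: cst_continuous.
split=> // v.
have -> : (fun x : V => 'D_v (fun=> c) x) = fun=> 0 :> W.
  by apply/funext => x; rewrite derive_cst.
exact: IH.
Qed.

Lemma CkD V W k (U : set V) (f g : V -> W) : open U ->
  Ck k U f -> Ck k U g -> Ck k U (fun x => f x + g x).
Proof.
move=> oU; elim: k f g => [|k IH] f g /=.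
  by move=> cf cg x Ux; apply: continuousD; [exact: cf|exact: cg].
move=> [df Df] [dg Dg]; split=> [x Ux|v].
  by apply: differentiableD; [exact: df|exact: dg].
apply: Ck_ext (IH _ _ (Df v) (Dg v)) => // x Ux.
by rewrite deriveD//; apply: diff_derivable; [exact: df|exact: dg].
Qed.

Lemma Ck_sum V W k (U : set V) n (f : 'I_n -> V -> W) : open U ->
  (forall i, Ck k U (f i)) -> Ck k U (fun x => \sum_(i < n) f i x).
Proof.
move=> oU; elim: n f => [|n IH] f cf.
  apply: Ck_ext (Ck_cst k U 0) => // x _; by rewrite big_ord0.
apply: (@Ck_ext _ _ _ _ (fun x => f ord0 x + \sum_(i < n) f (lift ord0 i) x)) => //.
  by move=> x _; rewrite big_ord_recl.
apply: CkD => //; exact: IH.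
Qed.

Definition scale_op W (a : R) (w : W) : W := a *: w.

Lemma scale_op_is_bilinear W :
  bilinear_for (GRing.Scale.Law.clone _ _ *:%R _)
    (GRing.Scale.Law.clone _ _ *:%R _) (@scale_op W).
Proof.
rewrite /scale_op; split=> [u'|u] a x y /=; first by rewrite scalerDl scalerA.
by rewrite scalerDr !scalerA mulrC.
Qed.
HB.instance Definition _ W := bilinear_isBilinear.Build R R W W _ _
  (@scale_op W) (@scale_op_is_bilinear W).

Lemma diff_scale V W (a : V -> R) (f : V -> W) x :
  differentiable a x -> differentiable f x ->
  differentiable (fun y => a y *: f y) x /\
  forall v, 'D_v (fun y => a y *: f y) x = a x *: 'D_v f x + 'D_v a x *: f x.
Proof.
move=> da df.
have sc : continuous (fun p : R * W => p.1 *: p.2) := @scale_continuous _ W.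
pose B : {bilinear R -> W -> W} := @scale_op W.
have dB : differentiable (fun p : R * W => B p.1 p.2) (a x, f x).
  exact: differentiable_bilin.
have dp : differentiable (fun y => (a y, f y)) x by exact: differentiable_pair.
have dc : differentiable (fun y => a y *: f y) x := differentiable_comp dp dB.
split=> // v.
rewrite !deriveE//.
have -> : 'd (fun y => a y *: f y) x = 'd ((fun p : R * W => B p.1 p.2) \o (fun y => (a y, f y))) x by [].
by rewrite diff_comp// diff_bilin// diff_pair.
Qed.

Lemma CkZ V W k (U : set V) (a : V -> R) (f : V -> W) : open U ->
  Ck k U a -> Ck k U f -> Ck k U (fun x => a x *: f x).
Proof.
move=> oU; elim: k a f => [|k IH] a f.
  by move=> ca cf x Ux; apply: continuousZ; [exact: ca|exact: cf].
move=> ca cf; have [da Da] := ca; have [df Df] := cf; split=> [x Ux|v].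
  by have [] := diff_scale (da x Ux) (df x Ux).
apply: (@Ck_ext _ _ _ _ (fun x => a x *: 'D_v f x + 'D_v a x *: f x)) => //.
  by move=> x Ux; have [_ ->] := diff_scale (da x Ux) (df x Ux).
by apply: CkD => //; apply: IH => //; first [exact: Df|exact: Da|exact: CkS ca|exact: CkS cf].
Qed.

Lemma Ck_linear V W W' k (U : set V) (f : V -> W) (l : {linear W -> W'}) :
  open U -> continuous l -> Ck k U f -> Ck k U (fun x => l (f x)).
Proof.
move=> oU cl; elim: k f => [|k IH] f.
  by move=> cf x Ux; apply: continuous_comp; [exact: cf|exact: cl].
move=> [df Df].
have dl y : differentiable l y by exact: linear_differentiable.
have dlf x (Ux : U x) := differentiable_comp (df x Ux) (dl (f x)).
split=> // v; apply: Ck_ext (IH _ (Df v)) => // x Ux.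
rewrite (deriveE v (dlf x Ux)) (diff_comp (df x Ux) (dl (f x))).
by rewrite /= diff_lin// deriveE//; exact: df.
Qed.

Lemma Ck_coord V k (U : set V) n (f : V -> 'rV[R]_n) i : open U ->
  Ck k U f -> Ck k U (fun x => f x ord0 i).
Proof.
move=> oU cf.
have @l : {linear 'rV[R]_n -> R}.
  by exists (fun N : 'rV[R]_n => N ord0 i); do 2![eexists]; do ?[constructor];
     rewrite ?mxE// => ? *; rewrite ?mxE//; move=> ?; rewrite !mxE.
exact: (Ck_linear (l := l) oU (@coord_continuous _ _ _ _ _)).
Qed.

Lemma Ck_comp V W k n (U : set V) (U' : set 'rV[R]_n) (f : V -> 'rV[R]_n)
    (g : 'rV[R]_n -> W) : open U -> (forall x, U x -> U' (f x)) ->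
  Ck k U f -> Ck k U' g -> Ck k U (g \o f).
Proof.
move=> oU fU; elim: k g => [|k IH] g.
  move=> cf cg x Ux; apply: continuous_comp; first exact: cf.
  exact/cg/fU.
move=> cf [dg Dg]; have [df Df] := cf; split=> [x Ux|v].
  by apply: differentiable_comp; [exact: df|exact/dg/fU].
apply: (@Ck_ext _ _ _ _ (fun x => \sum_(i < n)
    ('D_v f x ord0 i) *: (fun y => 'D_(delta_mx 0 i) g y) (f x))) => //.
  move=> x Ux; have dfx := df x Ux; have dgx := dg _ (fU x Ux).
  rewrite (deriveE v (differentiable_comp dfx dgx)) (diff_comp dfx dgx) /=.
  rewrite deriveE// [in RHS](row_sum_delta ('d f x v)) linear_sum.
  by apply: eq_bigr => i _; rewrite linearZ /= deriveE.
apply: Ck_sum => // i; apply: CkZ => //; first exact: Ck_coord (Df v).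
exact: (IH (fun y => 'D_(delta_mx 0 i) g y) (CkS cf) (Dg _)).
Qed.

Lemma Ck_id V k (U : set V) : Ck k U (@id V).
Proof.
case: k => [|k] /=; first by move=> x _.
split=> // v; have -> : (fun x : V => 'D_v id x) = fun=> v.
  by apply/funext => x; exact: derive_id.
exact: Ck_cst.
Qed.
End Smooth.

(* A map from U to X is encoded by a total map 'rV_n -> X of which only the    *)
(* values on U matter ([plot_ext]); no information is lost, since a map U -> X *)
(* extends to 'rV_n as soon as X is inhabited, and if X is empty then U is     *)
(* empty and the diffeology on X is unique.                                    *)
Record diffeology (R : realType) (X : Type) := Diffeology {
  plot : forall n, set 'rV[R]_n -> ('rV[R]_n -> X) -> Prop ;
  plot_open : forall n (U : set 'rV[R]_n) p, plot U p -> open U ;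
  plot_ext : forall n (U : set 'rV[R]_n) p q,
    (forall u, U u -> p u = q u) -> plot U p -> plot U q ;
  plot_cst : forall n (U : set 'rV[R]_n) x, open U -> plot U (fun=> x) ;
  plot_comp : forall m n (U : set 'rV[R]_n) (V : set 'rV[R]_m) p
      (f : 'rV[R]_m -> 'rV[R]_n),
    plot U p -> open V -> smooth_on V f -> (forall v, V v -> U (f v)) ->
    plot V (p \o f) ;
  plot_local : forall n (U : set 'rV[R]_n) p, open U ->
    (forall u, U u -> exists W, [/\ W u, W `<=` U & plot W p]) -> plot U p
}.

Section Diffeologies.
Context {R : realType}.
Implicit Types X Y Z : Type.

Definition smooth X Y (D : diffeology R X) (E : diffeology R Y) (f : X -> Y) :=
  forall n (U : set 'rV[R]_n) p, plot D U p -> plot E U (f \o p).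

Record smooth_map X Y (D : diffeology R X) (E : diffeology R Y) := SmoothMap {
  smooth_fun :> X -> Y ;
  smooth_funP : smooth D E smooth_fun
}.

Definition locally_lifts X Y (D : diffeology R X) (f : X -> Y)
    n (U : set 'rV[R]_n) (p : 'rV[R]_n -> Y) :=
  forall u, U u -> exists W q,
    [/\ W u, W `<=` U, plot D W q & forall w, W w -> p w = f (q w)].

Definition subduction X Y (D : diffeology R X) (E : diffeology R Y)
    (f : X -> Y) :=
  [/\ smooth D E f, (forall y, exists x, f x = y) &
      forall n (U : set 'rV[R]_n) p, plot E U p <-> locally_lifts D f U p].

(* The diffeology induced by i : Y -> X; it is only used for injective i,      *)
(* where it is the sub-diffeology.                                             *)
Section Sub.
Variables (X Y : Type) (D : diffeology R X) (i : Y -> X).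
Let sub_plot n (U : set 'rV[R]_n) (p : 'rV[R]_n -> Y) := plot D U (i \o p).

Let sub_open n (U : set 'rV[R]_n) p : sub_plot U p -> open U.
Proof. exact: plot_open. Qed.

Let sub_ext n (U : set 'rV[R]_n) p q :
  (forall u, U u -> p u = q u) -> sub_plot U p -> sub_plot U q.
Proof. by move=> pq; apply: plot_ext => u /pq /= ->. Qed.

Let sub_cst n (U : set 'rV[R]_n) y : open U -> sub_plot U (fun=> y).
Proof. exact: plot_cst. Qed.

Let sub_comp m n (U : set 'rV[R]_n) (V : set 'rV[R]_m) p
    (f : 'rV[R]_m -> 'rV[R]_n) :
  sub_plot U p -> open V -> smooth_on V f -> (forall v, V v -> U (f v)) ->
  sub_plot V (p \o f).
Proof. exact: plot_comp. Qed.

Let sub_local n (U : set 'rV[R]_n) p : open U ->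
  (forall u, U u -> exists W, [/\ W u, W `<=` U & sub_plot W p]) ->
  sub_plot U p.
Proof. exact: plot_local. Qed.

Definition sub_diff : diffeology R Y :=
  Diffeology sub_open sub_ext sub_cst sub_comp sub_local.

Lemma sub_smooth : smooth sub_diff D i.
Proof. by []. Qed.
End Sub.

Section Prod.
Variables (X Y : Type) (D : diffeology R X) (E : diffeology R Y).
Let prod_plot n (U : set 'rV[R]_n) (p : 'rV[R]_n -> X * Y) :=
  plot D U (fst \o p) /\ plot E U (snd \o p).

Let prod_open n (U : set 'rV[R]_n) p : prod_plot U p -> open U.
Proof. by move=> [/plot_open]. Qed.

Let prod_ext n (U : set 'rV[R]_n) p q :
  (forall u, U u -> p u = q u) -> prod_plot U p -> prod_plot U q.
Proof.
by move=> pq [p1 p2]; split; [apply: plot_ext p1|apply: plot_ext p2];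
  move=> u /pq /= ->.
Qed.

Let prod_cst n (U : set 'rV[R]_n) z : open U -> prod_plot U (fun=> z).
Proof. by move=> oU; split; apply: plot_cst. Qed.

Let prod_comp m n (U : set 'rV[R]_n) (V : set 'rV[R]_m) p
    (f : 'rV[R]_m -> 'rV[R]_n) :
  prod_plot U p -> open V -> smooth_on V f -> (forall v, V v -> U (f v)) ->
  prod_plot V (p \o f).
Proof.
by move=> [p1 p2] oV sf fU; split; [apply: plot_comp p1 _ _ _|
  apply: plot_comp p2 _ _ _].
Qed.

Let prod_local n (U : set 'rV[R]_n) p : open U ->
  (forall u, U u -> exists W, [/\ W u, W `<=` U & prod_plot W p]) ->
  prod_plot U p.
Proof.
move=> oU H; split; apply: plot_local => // u /H[W [Wu WU [p1 p2]]];
  by exists W.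
Qed.

Definition prod_diff : diffeology R (X * Y) :=
  Diffeology prod_open prod_ext prod_cst prod_comp prod_local.
End Prod.

Section Quotient.
Variables (X Y : Type) (D : diffeology R X) (f : X -> Y).
Hypothesis f_surj : forall y, exists x, f x = y.

Let quo_open n (U : set 'rV[R]_n) p : locally_lifts D f U p -> open U.
Proof.
move=> H; rewrite openE => u /H[W [q [Wu WU /plot_open oW _]]].
by apply: (filterS WU); apply: open_nbhs_nbhs.
Qed.

Let quo_ext n (U : set 'rV[R]_n) p q : (forall u, U u -> p u = q u) ->
  locally_lifts D f U p -> locally_lifts D f U q.
Proof.
move=> pq H u /H[W [r [Wu WU Wr pr]]]; exists W, r; split=> // w Ww.
by rewrite -pq ?pr//; apply: WU.
Qed.

Let quo_cst n (U : set 'rV[R]_n) y : open U -> locally_lifts D f U (fun=> y).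
Proof.
move=> oU u Uu; have [x xy] := f_surj y.
by exists U, (fun=> x); split=> //; apply: plot_cst.
Qed.

Let quo_comp m n (U : set 'rV[R]_n) (V : set 'rV[R]_m) p
    (g : 'rV[R]_m -> 'rV[R]_n) :
  locally_lifts D f U p -> open V -> smooth_on V g ->
  (forall v, V v -> U (g v)) -> locally_lifts D f V (p \o g).
Proof.
move=> H oV sg gU v Vv; have [W [q [Wgv WU Wq pq]]] := H _ (gU v Vv).
have oVW : open (V `&` g @^-1` W).
  rewrite openE => x [Vx Wx]; apply: filterI.
    exact: open_nbhs_nbhs.
  apply: (sg 0%N x Vx); apply: open_nbhs_nbhs; split=> //.
  exact: plot_open Wq.
exists (V `&` g @^-1` W), (q \o g); split=> //.
- apply: (plot_comp Wq) => //; last by move=> x [].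
  by move=> k; apply: Ck_sub (sg k) => x [].
- by move=> w [_ /pq].
Qed.

Let quo_local n (U : set 'rV[R]_n) p : open U ->
  (forall u, U u -> exists W, [/\ W u, W `<=` U & locally_lifts D f W p]) ->
  locally_lifts D f U p.
Proof.
move=> oU H u /H[W [Wu WU /(_ u Wu)[W' [q [W'u W'W W'q pq]]]]].
by exists W', q; split=> // x /W'W /WU.
Qed.

Definition quotient_diff : diffeology R Y :=
  Diffeology quo_open quo_ext quo_cst quo_comp quo_local.

Lemma quotient_smooth : smooth D quotient_diff f.
Proof.
move=> n U p pU u Uu.
by exists U, p; split.
Qed.
End Quotient.

Section Real.
Let real_plot n (U : set 'rV[R]_n) (p : 'rV[R]_n -> R) :=
  open U /\ smooth_on U p.

Let real_open n (U : set 'rV[R]_n) p : real_plot U p -> open U.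
Proof. by case. Qed.

Let real_ext n (U : set 'rV[R]_n) p q :
  (forall u, U u -> p u = q u) -> real_plot U p -> real_plot U q.
Proof. by move=> pq [oU sp]; split=> // k; apply: Ck_ext pq (sp k). Qed.

Let real_cst n (U : set 'rV[R]_n) y : open U -> real_plot U (fun=> y).
Proof. by move=> oU; split=> // k; apply: Ck_cst. Qed.

Let real_comp m n (U : set 'rV[R]_n) (V : set 'rV[R]_m) p
    (f : 'rV[R]_m -> 'rV[R]_n) :
  real_plot U p -> open V -> smooth_on V f -> (forall v, V v -> U (f v)) ->
  real_plot V (p \o f).
Proof. by move=> [oU sp] oV sf fU; split=> // k; apply: Ck_comp fU _ _. Qed.

Let real_local n (U : set 'rV[R]_n) p : open U ->
  (forall u, U u -> exists W, [/\ W u, W `<=` U & real_plot W p]) ->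
  real_plot U p.
Proof.
move=> oU H; split=> // k; apply: Ck_local => u /H[W [Wu WU [_ sW]]].
by exists W.
Qed.

Definition real_diff : diffeology R R :=
  Diffeology real_open real_ext real_cst real_comp real_local.
End Real.

(* The plots common to all diffeologies satisfying P; this is the smallest     *)
(* diffeology satisfying P whenever P is stable under intersection.            *)
Section Smallest.
Variables (X : Type) (P : diffeology R X -> Prop).
Let inter_plot n (U : set 'rV[R]_n) (p : 'rV[R]_n -> X) :=
  open U /\ forall D, P D -> plot D U p.

Let inter_open n (U : set 'rV[R]_n) p : inter_plot U p -> open U.
Proof. by case. Qed.

Let inter_ext n (U : set 'rV[R]_n) p q :
  (forall u, U u -> p u = q u) -> inter_plot U p -> inter_plot U q.
Proof.
by move=> pq [oU H]; split=> // D /H; apply: plot_ext.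
Qed.

Let inter_cst n (U : set 'rV[R]_n) y : open U -> inter_plot U (fun=> y).
Proof. by move=> oU; split=> // D _; apply: plot_cst. Qed.

Let inter_comp m n (U : set 'rV[R]_n) (V : set 'rV[R]_m) p
    (f : 'rV[R]_m -> 'rV[R]_n) :
  inter_plot U p -> open V -> smooth_on V f -> (forall v, V v -> U (f v)) ->
  inter_plot V (p \o f).
Proof.
by move=> [oU H] oV sf fU; split=> // D /H pD; apply: plot_comp pD _ _ _.
Qed.

Let inter_local n (U : set 'rV[R]_n) p : open U ->
  (forall u, U u -> exists W, [/\ W u, W `<=` U & inter_plot W p]) ->
  inter_plot U p.
Proof.
move=> oU H; split=> // D PD; apply: plot_local => // u /H[W [Wu WU [_ pW]]].
by exists W; split=> //; apply: pW.
Qed.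

Definition smallest_diff : diffeology R X :=
  Diffeology inter_open inter_ext inter_cst inter_comp inter_local.
End Smallest.

End Diffeologies.

Section Tangent.
Context {R : realType} {X : Type}.
Implicit Types (D : diffeology R X) (x : X).

Record pplot D x := PPlot {
  pdim : nat ;
  pdom : set 'rV[R]_pdim ;
  pfun : 'rV[R]_pdim -> X ;
  pdom_connected : connected pdom ;
  pdom0 : pdom 0 ;
  pfun_plot : plot D pdom pfun ;
  pfun0 : pfun 0 = x
}.

Arguments pdom {D x} p.
Arguments pfun {D x} p.
Arguments pdom_connected {D x} p.
Arguments pdom0 {D x} p.
Arguments pfun_plot {D x} p.
Arguments pfun0 {D x} p.

(* f represents a germ p -> q in the germ category *)
Definition germ_mor D x (p q : pplot D x) (f : 'rV[R]_(pdim p) -> 'rV[R]_(pdim q)) :=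
  f 0 = 0 /\
  exists W : set 'rV[R]_(pdim p), [/\ open W, W 0, W `<=` pdom p, smooth_on W f &
    forall w, W w -> pdom q (f w) /\ pfun p w = pfun q (f w)].

(* A list [:: (p_1, u_1); ...; (p_k, u_k)] stands for the formal sum           *)
(* p_1*(u_1) + ... + p_k*(u_k).                                                *)
Definition formal_sum D x := seq {p : pplot D x & 'rV[R]_(pdim p)}.
Definition fterm D x (p : pplot D x) (u : 'rV[R]_(pdim p)) :
  {p : pplot D x & 'rV[R]_(pdim p)} := existT (fun p => 'rV[R]_(pdim p)) p u.

(* The congruence presenting the colimit of p |-> T_0(U): formal sums          *)
(* commute, are additive in the vectors, and (p, u) ~ (q, d_0 f u) for every   *)
(* germ f : p -> q.                                                            *)
Inductive colim_eq D x : formal_sum D x -> formal_sum D x -> Prop :=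
| colim_refl s : colim_eq s s
| colim_sym s t : colim_eq s t -> colim_eq t s
| colim_trans s t r : colim_eq s t -> colim_eq t r -> colim_eq s r
| colim_cat s s' t t' :
    colim_eq s s' -> colim_eq t t' -> colim_eq (s ++ t) (s' ++ t')
| colim_catC s t : colim_eq (s ++ t) (t ++ s)
| colim_zero p : colim_eq [:: fterm (p := p) 0] [::]
| colim_add p u v :
    colim_eq [:: fterm (p := p) (u + v)] [:: fterm u; fterm v]
| colim_germ p q f u : germ_mor f ->
    colim_eq [:: fterm (p := p) u] [:: fterm (p := q) ('d f 0 u)].

Definition fscale D x (a : R) (s : formal_sum D x) : formal_sum D x :=
  [seq fterm (a *: tagged e) | e : {p : pplot D x & 'rV[R]_(pdim p)} <- s].

Lemma colim_catl D x (s t t' : formal_sum D x) :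
  colim_eq t t' -> colim_eq (s ++ t) (s ++ t').
Proof. by move=> tt; apply: colim_cat => //; apply: colim_refl. Qed.

Lemma colim_catr D x (s s' t : formal_sum D x) :
  colim_eq s s' -> colim_eq (s ++ t) (s' ++ t).
Proof. by move=> tt; apply: colim_cat => //; apply: colim_refl. Qed.

Lemma colim_scale D x a (s t : formal_sum D x) :
  colim_eq s t -> colim_eq (fscale a s) (fscale a t).
Proof.
rewrite /fscale; elim=> {s t}.
- by move=> s; apply: colim_refl.
- by move=> s t _; apply: colim_sym.
- by move=> s t r _ st _; apply: colim_trans.
- by move=> s s' t t' _ ss _ tt; rewrite !map_cat; apply: colim_cat.
- by move=> s t; rewrite !map_cat; apply: colim_catC.
- by move=> p /=; rewrite scaler0; apply: colim_zero.
- by move=> p u v /=; rewrite scalerDr; apply: colim_add.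
- by move=> p q f u fpq /=; rewrite -linearZ; apply: colim_germ.
Qed.

Lemma colim_scaleDl D x a b (s : formal_sum D x) :
  colim_eq (fscale (a + b) s) (fscale a s ++ fscale b s).
Proof.
elim: s => [|[p u] s IH] /=; first exact: colim_refl.
rewrite /= scalerDl.
set su := fterm (a *: u); set sv := fterm (b *: u).
set sa := fscale a s in IH *; set sb := fscale b s in IH *.
apply: (@colim_trans _ _ _ ([:: su; sv] ++ (sa ++ sb))).
  by rewrite -cat1s; apply: colim_cat => //; apply: colim_add.
change (colim_eq ([:: su] ++ (([:: sv] ++ sa) ++ sb))
                 ([:: su] ++ (sa ++ ([:: sv] ++ sb)))).
apply: colim_catl; rewrite [X in colim_eq _ X]catA; apply: colim_catr.
exact: colim_catC.
Qed.

Lemma colim_scale0 D x (s : formal_sum D x) : colim_eq (fscale 0 s) [::].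
Proof.
elim: s => [|[p u] s IH] /=; first exact: colim_refl.
rewrite /= scale0r -cat1s -[X in colim_eq _ X]cats0.
by apply: colim_cat => //; apply: colim_zero.
Qed.

HB.instance Definition _ D x := gen_eqMixin (pplot D x).
HB.instance Definition _ D x := gen_choiceMixin (pplot D x).
HB.instance Definition _ D x := Choice.on (formal_sum D x).

Definition colim_eqb D x : rel (formal_sum D x) := fun s t => `[< colim_eq s t >].

Lemma colim_eqb_equiv D x : equiv_class_of (@colim_eqb D x).
Proof.
split=> [s|s t|s t r].
- by apply/asboolP/colim_refl.
- by apply/asboolP/asboolP => /colim_sym.
- by move=> /asboolP st /asboolP tr; apply/asboolP/(colim_trans st tr).
Qed.

Canonical colim_equiv D x := EquivRelPack (@colim_eqb_equiv D x).

(* The internal tangent space T_x(X): [tvec_germ], [tlift_tvec] and            *)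
(* [tlift_uniq] below show that it is the colimit of p |-> T_0(U), with        *)
(* coprojections the linear maps [tvec p].                                     *)
Definition tangent D x : Type := {eq_quot (@colim_equiv D x)}.

HB.instance Definition _ D x := Choice.on (tangent D x).
HB.instance Definition _ D x := Quotient.on (tangent D x).
HB.instance Definition _ D x := EqQuotient.on (tangent D x).

Definition tclass D x (s : formal_sum D x) : tangent D x :=
  \pi_(tangent D x)%qT s.

Lemma tclassP D x (s t : formal_sum D x) : tclass s = tclass t <-> colim_eq s t.
Proof. by split=> [/eqmodP/asboolP//|st]; apply/eqmodP/asboolP. Qed.

Lemma tclass_repr D x (t : tangent D x) : tclass (repr t) = t.
Proof. exact: reprK. Qed.

Lemma repr_tclass D x (s : formal_sum D x) : colim_eq (repr (tclass s)) s.
Proof. by apply/tclassP; rewrite tclass_repr. Qed.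

Section Lmodule.
Variables (D : diffeology R X) (x : X).
Implicit Types t : tangent D x.

Definition tadd t1 t2 := tclass (repr t1 ++ repr t2).
Definition tscale (a : R) t := tclass (fscale a (repr t)).
Definition topp t := tscale (-1) t.
Definition tzero : tangent D x := tclass [::].

Lemma tclass_cat (s1 s2 : formal_sum D x) :
  tclass (s1 ++ s2) = tadd (tclass s1) (tclass s2).
Proof.
by apply/tclassP/colim_sym/colim_cat; apply: repr_tclass.
Qed.

Lemma tclass_scale a (s : formal_sum D x) :
  tclass (fscale a s) = tscale a (tclass s).
Proof. by apply/tclassP/colim_sym/colim_scale/repr_tclass. Qed.

Lemma taddA : associative tadd.
Proof.
move=> t1 t2 t3.
rewrite -(tclass_repr t1) -(tclass_repr t2) -(tclass_repr t3).
by rewrite -!tclass_cat catA.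
Qed.

Lemma taddC : commutative tadd.
Proof. by move=> t1 t2; apply/tclassP/colim_catC. Qed.

Lemma tadd0 : left_id tzero tadd.
Proof. by move=> t; rewrite -(tclass_repr t) /tzero -tclass_cat. Qed.

Lemma tscaleDl t a b : tscale (a + b) t = tadd (tscale a t) (tscale b t).
Proof. by rewrite -tclass_cat; apply/tclassP/colim_scaleDl. Qed.

Lemma tscale1 : left_id 1 tscale.
Proof.
move=> t; rewrite -[RHS]tclass_repr /tscale /fscale; congr tclass.
by rewrite -[RHS]map_id; apply: eq_map => -[p u] /=; rewrite scale1r.
Qed.

Lemma taddN : left_inverse tzero topp tadd.
Proof.
move=> t; rewrite -[X in tadd _ X]tscale1 /topp -tscaleDl addNr.
exact/tclassP/colim_scale0.
Qed.

Lemma tscaleA a b t : tscale a (tscale b t) = tscale (a * b) t.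
Proof.
rewrite -(tclass_repr t) -!tclass_scale; congr tclass.
by rewrite /fscale -map_comp; apply: eq_map => -[p u] /=; rewrite scalerA.
Qed.

Lemma tscaleDr : right_distributive tscale tadd.
Proof.
move=> a t1 t2; rewrite -(tclass_repr t1) -(tclass_repr t2) -tclass_cat.
by rewrite -!tclass_scale -tclass_cat /fscale map_cat.
Qed.

HB.instance Definition _ :=
  GRing.isZmodule.Build (tangent D x) taddA taddC tadd0 taddN.
HB.instance Definition _ := GRing.Zmodule_isLmodule.Build R (tangent D x)
  tscaleA tscale1 tscaleDr tscaleDl.

(* p_*(u) *)
Definition tvec (p : pplot D x) (u : 'rV[R]_(pdim p)) : tangent D x :=
  tclass [:: fterm u].

Lemma tvec_is_linear p : linear (@tvec p).
Proof.
move=> a u v; transitivity (tclass (fscale a [:: fterm u] ++ [:: fterm v])).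
  exact/tclassP/colim_add.
by rewrite tclass_cat tclass_scale.
Qed.
HB.instance Definition _ p := GRing.isLinear.Build R 'rV[R]_(pdim p)
  (tangent D x) *:%R (@tvec p) (@tvec_is_linear p).

Lemma tvec_germ (p q : pplot D x) (f : 'rV[R]_(pdim p) -> 'rV[R]_(pdim q)) u :
  germ_mor f -> tvec ('d f 0 u) = tvec u.
Proof. by move=> fpq; apply/tclassP/colim_sym/colim_germ. Qed.

Lemma tclass_sum (s : formal_sum D x) :
  tclass s = \sum_(e <- s) tvec (tagged e).
Proof.
elim: s => [|[p u] s IH]; first by rewrite big_nil.
by rewrite big_cons -IH -cat1s tclass_cat.
Qed.

Section Universal.
Variables (V : lmodType R) (c : forall p : pplot D x, 'rV[R]_(pdim p) -> V).
Arguments c : clear implicits.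
Hypothesis c_linear : forall p, linear (c p).
Hypothesis c_germ : forall (p q : pplot D x)
  (f : 'rV[R]_(pdim p) -> 'rV[R]_(pdim q)) u,
  germ_mor f -> c q ('d f 0 u) = c p u.

Definition tlift (t : tangent D x) : V :=
  \sum_(e <- repr t) c (tag e) (tagged e).

Let cD p u v : c p (u + v) = c p u + c p v.
Proof. by rewrite -[u]scale1r c_linear !scale1r. Qed.
Let c0 p : c p 0 = 0.
Proof. by apply: (addrI (c p 0)); rewrite -cD !addr0. Qed.
Let cZ p a u : c p (a *: u) = a *: c p u.
Proof. by rewrite -[a *: u]addr0 c_linear c0 addr0. Qed.

Lemma tlift_tclass s : tlift (tclass s) = \sum_(e <- s) c (tag e) (tagged e).
Proof.
suff H s1 s2 : colim_eq s1 s2 -> \sum_(e <- s1) c (tag e) (tagged e) =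
    \sum_(e <- s2) c (tag e) (tagged e) by exact/H/repr_tclass.
elim=> {s s1 s2} //.
- by move=> s t r _ -> _ ->.
- by move=> s s' t t' _ ss _ tt; rewrite !big_cat /= ss tt.
- by move=> s t; rewrite !big_cat /= addrC.
- by move=> p; rewrite big_seq1 big_nil /= c0.
- by move=> p u v; rewrite !big_cons !big_nil /= !addr0 cD.
- by move=> p q f u /c_germ fpq; rewrite !big_seq1 /= fpq.
Qed.

Lemma tlift_is_linear : linear tlift.
Proof.
move=> a t1 t2; rewrite -(tclass_repr t1) -(tclass_repr t2).
have -> : a *: tclass (repr t1) + tclass (repr t2) =
  tclass (fscale a (repr t1) ++ repr t2) by rewrite tclass_cat tclass_scale.
rewrite !tlift_tclass big_cat /=.
rewrite big_map scaler_sumr; congr (_ + _).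
by apply: eq_bigr => e _ /=; rewrite cZ.
Qed.

Lemma tlift_tvec p u : tlift (@tvec p u) = c p u.
Proof. by rewrite tlift_tclass big_seq1. Qed.

Lemma tlift_uniq (h : {linear tangent D x -> V}) :
  (forall p u, h (@tvec p u) = c p u) -> h =1 tlift.
Proof.
move=> hc t; rewrite -(tclass_repr t) tlift_tclass tclass_sum linear_sum.
by apply: eq_bigr => e _; rewrite hc.
Qed.
End Universal.
End Lmodule.
End Tangent.

Arguments tvec {R X D x} p u.
Arguments pdom {R X D x} p.
Arguments pfun {R X D x} p.
Arguments pdom_connected {R X D x} p.
Arguments pdom0 {R X D x} p.
Arguments pfun_plot {R X D x} p.
Arguments pfun0 {R X D x} p.

Section TangentMap.
Context {R : realType} {X Y : Type}.
Variables (D : diffeology R X) (E : diffeology R Y) (f : smooth_map D E) (x : X).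

Section Push.
Variable p : pplot D x.

Let push0 : (f \o pfun p) 0 = f x.
Proof. by rewrite /= pfun0. Qed.

Definition push_pplot : pplot E (f x) :=
  PPlot (pdom_connected p) (pdom0 p)
    (smooth_funP f (pfun_plot p)) push0.
End Push.

(* The linear map f_* : T_x(X) -> T_{f(x)}(Y) determined by [tmapE].           *)
Definition tmap : tangent D x -> tangent E (f x) :=
  tlift (fun p u => tvec (push_pplot p) u).

Let push_linear p : linear (tvec (push_pplot p)).
Proof. exact: linearP. Qed.

Let push_germ (p q : pplot D x) (g : 'rV[R]_(pdim p) -> 'rV[R]_(pdim q)) u :
  germ_mor g -> tvec (push_pplot q) ('d g 0 u) = tvec (push_pplot p) u.
Proof.
move=> [g0 [W [oW W0 Wp sg gW]]].
apply: (@tvec_germ _ _ _ _ (push_pplot p) (push_pplot q)); split=> //.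
by exists W; split=> // w /gW[/= ? ->].
Qed.

Lemma tmap_is_linear : linear tmap.
Proof. exact: tlift_is_linear push_linear push_germ. Qed.

HB.instance Definition _ := GRing.isLinear.Build R (tangent D x)
  (tangent E (f x)) *:%R tmap tmap_is_linear.

Lemma tmapE (p : pplot D x) u : tmap (tvec p u) = tvec (push_pplot p) u.
Proof. exact: tlift_tvec push_linear push_germ _ _. Qed.
End TangentMap.

Arguments tmap {R X Y D E} f x t.

Section Bundle.
Context {R : realType} {X : Type}.
Variable D : diffeology R X.

Definition tbundle : Type := {x : X & tangent D x}.

Definition in_fiber x (t : tangent D x) : tbundle := existT (tangent D) x t.

Section TangentPlot.
Variables (n : nat) (U : set 'rV[R]_n) (p : 'rV[R]_n -> X).
Hypothesis pU : plot D U p.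

Lemma ball0_connected (r : R) : connected (ball (0 : 'rV[R]_n) r).
Proof.
have -> : ball (0 : 'rV[R]_n) r =
    \bigcup_(v in ball (0 : 'rV[R]_n) r) ((fun t : R => t *: v) @` `[0, 1]).
  apply/seteqP; split=> [v rv|w [v rv [t]]].
    by exists v => //; exists 1; rewrite /= ?in_itv/= ?ler01 ?lexx ?scale1r.
  rewrite /= in_itv /= => /andP[t0 t1] <-.
  move: rv; rewrite -!ball_normE /= !sub0r !normrN normrZ (ger0_norm t0).
  by apply: le_lt_trans; rewrite ler_piMl.
apply: bigcup_connected.
  exists 0 => v _; exists 0; last by rewrite scale0r.
  by rewrite /= in_itv /= lexx ler01.
move=> v _; apply: connected_continuous_connected.
  exact: segment_connected.
by apply: continuous_subspaceT => t; exact: scalel_continuous.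
Qed.

Section At.
Variable u : 'rV[R]_n.
Hypothesis Uu : U u.

Let ball_sub : exists r : {posnum R}, ball u r%:num `<=` U.
Proof.
have : nbhs u U by apply: open_nbhs_nbhs; split=> //; apply: plot_open pU.
by move=> /nbhs_ballP[r /= r0 rU]; exists (PosNum r0).
Qed.

Let rad : {posnum R} := projT1 (cid ball_sub).

Let shift_plot : plot D (ball (0 : 'rV[R]_n) rad%:num) (fun w => p (u + w)).
Proof.
apply: (plot_comp (f := fun w => u + w) pU).
- exact: ball_open.
- move=> k; apply: CkD; [exact: ball_open|exact: Ck_cst|exact: Ck_id].
- move=> w rw; apply: (projT2 (cid ball_sub)).
  move: rw; rewrite -/rad; move: (rad%:num) => r.
  by rewrite -!ball_normE /= sub0r opprD addNKr.
Qed.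

Let shift0 : (fun w => p (u + w)) 0 = p u.
Proof. by rewrite /= addr0. Qed.

(* w |-> p (u + w), restricted to some ball contained in its domain; the class *)
(* of a vector at it does not depend on this ball, see [Tplot_class].          *)
Definition shift_pplot : pplot D (p u) :=
  PPlot (ball0_connected (r := rad%:num)) (ballxx _ (gt0 rad)) shift_plot shift0.
End At.

(* Tp : TU -> TX with TU = U x R^n; its value outside TU is irrelevant         *)
Definition Tplot (z : 'rV[R]_n * 'rV[R]_n) : tbundle :=
  in_fiber (if pselect (U z.1) is left Uu then tvec (shift_pplot Uu) z.2 else 0).

Lemma Tplot_class u v (Uu : U u) (W : set 'rV[R]_n) (cW : connected W) (W0 : W 0)
    (pW : plot D W (fun w => p (u + w))) (e : p (u + 0) = p u) :
  Tplot (u, v) = in_fiber (tvec (PPlot cW W0 pW e) v).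
Proof.
rewrite /Tplot /=; case: pselect => // Uu'; congr in_fiber.
set q := shift_pplot Uu'; set q' := PPlot cW W0 pW e.
have oq : open (pdom q) := plot_open (pfun_plot q).
have oW : open W := plot_open pW.
have m : @germ_mor _ _ _ _ q q' (id : 'rV[R]_n -> 'rV[R]_n).
  split=> //; exists (pdom q `&` W); split.
  - exact: openI.
  - exact: (conj (pdom0 q) W0).
  - by move=> w [].
  - by move=> k; apply: Ck_id.
  - by move=> w [].
have did : 'd (id : 'rV[R]_n -> 'rV[R]_n) 0 v = v.
  by rewrite (_ : ('d id 0 : _ -> _) = id)//; exact: diff_val.
by have /= := @tvec_germ _ _ _ _ q q' id v m; rewrite did => ->.
Qed.
End TangentPlot.

(* Smoothness of all the Tp : TU -> TX, tested on the smooth f : V -> TU with  *)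
(* V open in some R^m.                                                         *)
Definition contains_Tplots (E : diffeology R tbundle) :=
  forall n (U : set 'rV[R]_n) p (pU : plot D U p)
    m (V : set 'rV[R]_m) (f : 'rV[R]_m -> 'rV[R]_n * 'rV[R]_n),
  open V -> smooth_on V f -> (forall v, V v -> U (f v).1) ->
  plot E V (Tplot pU \o f).

Definition hector_diff : diffeology R tbundle := smallest_diff contains_Tplots.

Definition bproj (z : tbundle) : X := projT1 z.

(* TX x_X TX, presented as the set of triples (x, v, w) with v, w in T_x(X)    *)
Definition bpair : Type := {x : X & (tangent D x * tangent D x)%type}.
Definition bpair_incl (z : bpair) : tbundle * tbundle :=
  (in_fiber (tagged z).1, in_fiber (tagged z).2).
Definition badd (z : bpair) : tbundle :=
  in_fiber ((tagged z).1 + (tagged z).2).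
Definition bscale (z : tbundle * R) : tbundle := in_fiber (z.2 *: tagged z.1).

Definition is_dvs (E : diffeology R tbundle) :=
  [/\ smooth E D bproj,
      smooth (sub_diff (prod_diff E E) bpair_incl) E badd &
      smooth (prod_diff E real_diff) E bscale].

Definition contains_hector (E : diffeology R tbundle) :=
  forall n (U : set 'rV[R]_n) p, plot hector_diff U p -> plot E U p.

Definition dvs_diff : diffeology R tbundle :=
  smallest_diff (fun E => contains_hector E /\ is_dvs E).

Lemma hector_contains_Tplots : contains_Tplots hector_diff.
Proof. by move=> n U p pU m V f oV sf fU; split=> // E; apply. Qed.

Lemma dvs_contains_hector : contains_hector dvs_diff.
Proof.
by move=> n U p pU; split=> [|E [+ _]]; [apply: plot_open pU|apply].
Qed.

(* [dvs_diff] is itself one of the diffeologies that it is the intersection of *)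
Lemma dvs_diff_dvs : is_dvs dvs_diff.
Proof.
have base_dvs : contains_hector (sub_diff D bproj) /\ is_dvs (sub_diff D bproj).
  split=> [n U p [_]|].
    apply=> {}n {}U {}p pU m V f oV sf fU.
    apply: (plot_comp (f := fst \o f) pU) => // k.
    apply: (Ck_linear (l := fst)) (sf k) => //.
    by move=> z; apply: cvg_fst.
  split=> [n U p //|n U p [p1 _]|n U p [p1 _]].
  - exact: p1.
  - exact: p1.
split=> [n U p [_]|n U p [[oU p1] [_ p2]]|n U p [[oU p1] p2]].
- by move=> /(_ _ base_dvs).
- split=> // E dE; have [_ [_ sA _]] := dE.
  by apply: sA; split; [apply: p1|apply: p2].
- split=> // E dE; have [_ [_ _ sS]] := dE.
  by apply: sS; split; [apply: p1|].
Qed.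

Definition fiber_diff (E : diffeology R tbundle) x : diffeology R (tangent D x) :=
  sub_diff E (@in_fiber x).
End Bundle.

Section Group.
Local Open Scope group_scope.
Context {R : realType} {G : groupType}.

Definition is_diff_group (D : diffeology R G) :=
  smooth (prod_diff D D) D (fun z => z.1 * z.2) /\ smooth D D (fun x => x^-1).

Variables (D : diffeology R G) (H : groupClosed G).

Definition subgroup : Type := {x : G | x \in H}.
Definition subgroup1 : subgroup := exist (fun x : G => x \in H) 1 gpred1.
Definition subgroup_diff : diffeology R subgroup := sub_diff D sval.
Definition subgroup_incl : smooth_map subgroup_diff D :=
  SmoothMap (sub_smooth (D := D) (i := sval)).

Definition left_coset (g : G) : set G := [set g * h | h in [set` H]].
Definition coset_space : Type := {C : set G | exists g, C = left_coset g}.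
Definition to_coset (g : G) : coset_space :=
  exist _ (left_coset g) (ex_intro _ g erefl).

Lemma to_coset_surj (C : coset_space) : exists g, to_coset g = C.
Proof. by case: C => C [g Cg]; exists g; exact/eq_exist/esym. Qed.

Definition coset_diff : diffeology R coset_space :=
  quotient_diff D to_coset_surj.
Definition coset_proj : smooth_map D coset_diff :=
  SmoothMap (quotient_smooth (D := D) to_coset_surj).
End Group.

Definition exact_at {R : realType} (U V W : lmodType R)
    (f : {linear U -> V}) (g : {linear V -> W}) :=
  forall v, g v = 0 <-> exists u, f u = v.

(* Main.v *)
Require Import Defs.
From HB Require Import structures.
From mathcomp Require Import all_boot all_order all_algebra.
From mathcomp Require Import all_classical all_reals all_analysis.

(** Write [pi : G -> G/H]. Three elementary facts carry everything.

    First, a plot [q] of [G/H] lifts locally to a plot [p] of [G], and two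
    lifts [p1], [p2] of the same map differ by the plot [p1^-1 * p2] of [H].

    Second, a tangent vector at one point depends linearly on the direction, so
    for a plot of [G] defined on a product of domains by multiplying plots, the
    vector in direction [(u, v)] is the sum of the partial vectors in
    directions [(u, 0)] and [(0, v)]: this is the Leibniz rule, and it needs
    the germ relations of the colimit along affine inclusions only
    ([Tplot_at_affine], [row_mx_split], [plot_ext_prod]).

    Third, the sum of two families of vectors [Tq1 (f1 w)], [Tq2 (f2 w)] of
    [T(G/H)] over the same base points is locally a single [Tq (f w)]
    ([coset_Tplots_addable]). If [p1], [p2] lift [q1], [q2], take
    [r (x, y, z) = p1 x * (p1 y)^-1 * p2 z] at [x = y], with direction zero in
    [y]. When [p1 y] and [p2 z] lie in one coset, moving [x] alone traces
    [q1 x] in [G/H], and when [x = y], moving [z] alone traces [q2 z].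

    The third fact makes every tangent vector of [G/H] a single [p_*(u)], so
    the plots of Hector's diffeology are exactly the local [Tq o f]
    ([hector_local_Tplot]) and fibrewise addition and scaling preserve them:
    Hector's diffeology on [T(G/H)] is already a vector space diffeology, hence
    equals the dvs one ([hector_eq_dvs]).

    A family [Tq (f w)] in the fibre over [eH], with [q = pi o p] near the
    point considered, is the image of the family of vectors at [e] of
    [y |-> p y * (p x)^-1], where [x] is the base point of [f w]; so [pi_*] is
    a subduction for Hector's diffeology ([hector_fiber_lift]), therefore also
    for the dvs one, and it is onto.

    For exactness at [T_e(G)], choosing a lift through [e] of each pointed plot
    of [G/H] sends formal sums over [G/H] to [T_e(G)]; congruent formal sums
    have images that agree modulo the image of [iota_*], because by the first
    two facts two lifts of one plot have vectors that differ by a vector of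
    [H] ([lifts_differ], [lift_sum_colim_eq]). For the same reason, pushing a
    vector of [T_e(G)] to [G/H] and lifting the resulting sum returns the vector
    modulo the image of [iota_*]; if its image in [T(G/H)] is zero, that sum is
    congruent to the empty one, so the vector comes from [H]. *)

Set Implicit Arguments.
Unset Strict Implicit.
Unset Printing Implicit Defensive.
Import Order.TTheory GRing.Theory Num.Theory.
Import numFieldNormedType.Exports.
Local Open Scope classical_set_scope.
Local Open Scope ring_scope.

(** * Smooth maps between spaces of row vectors *)

Section Calculus.
Context {R : realType}.
Implicit Types V W : normedModType R.

(** A linear map on row vectors is a finite sum of coordinates times constant
    vectors, so it is smooth whatever its normed target. *)
Lemma rV_linear_Ck W k n (U : set 'rV[R]_n) (l : {linear 'rV[R]_n -> W}) :
  Ck k U l.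
Proof.
apply: (@Ck_sub _ _ _ _ setT) => //.
apply: (@Ck_ext _ _ _ _ _ (fun x : 'rV[R]_n =>
    \sum_(i < n) x ord0 i *: l (delta_mx 0 i))); first exact: openT.
  move=> x _; rewrite [in RHS](row_sum_delta x) linear_sum.
  by apply: eq_bigr => i _; rewrite linearZ.
apply: Ck_sum => [|i]; first exact: openT.
apply: CkZ; [exact: openT| |exact: Ck_cst].
by apply: Ck_coord; [exact: openT|exact: Ck_id].
Qed.

Lemma rV_linear_continuous W n (l : {linear 'rV[R]_n -> W}) : continuous l.
Proof. by move=> x; apply: (@rV_linear_Ck _ 0 _ setT). Qed.

Lemma Ck_pair V W W' k (U : set V) (f : V -> W) (g : V -> W') : open U ->
  Ck k U f -> Ck k U g -> Ck k U (fun x => (f x, g x)).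
Proof.
move=> oU cf cg.
have lin1 : linear (fun x : W => (x, 0 : W')).
  by move=> a x y; congr pair; rewrite /= scaler0 addr0.
have lin2 : linear (fun x : W' => (0 : W, x)).
  by move=> a x y; congr pair; rewrite /= scaler0 addr0.
pose l1 : {linear W -> (W * W')%type} :=
  HB.pack (fun x : W => (x, 0 : W')) (GRing.isLinear.Build _ _ _ _ _ lin1).
pose l2 : {linear W' -> (W * W')%type} :=
  HB.pack (fun x : W' => (0 : W, x)) (GRing.isLinear.Build _ _ _ _ _ lin2).
apply: (@Ck_ext _ _ _ _ _ (fun x => l1 (f x) + l2 (g x))) => //.
  by move=> x _ /=; congr pair; rewrite ?addr0 ?add0r.
apply: CkD => //.
  apply: (Ck_linear (l := l1)) => // x.
  exact: (@cvg_pair _ _ _ _ _ _ _ _ _ (fun x => x) (fun=> 0)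
    (@cvg_id _ _) (cvg_cst _)).
apply: (Ck_linear (l := l2)) => // x.
exact: (@cvg_pair _ _ _ _ _ _ _ _ _ (fun=> 0) (fun x => x)
  (cvg_cst _) (@cvg_id _ _)).
Qed.

Lemma Ck_fst V W W' k (U : set V) (f : V -> W * W') : open U ->
  Ck k U f -> Ck k U (fun x => (f x).1).
Proof. by move=> oU; apply: (Ck_linear (l := fst)) => // z; apply: cvg_fst. Qed.

Lemma Ck_snd V W W' k (U : set V) (f : V -> W * W') : open U ->
  Ck k U f -> Ck k U (fun x => (f x).2).
Proof. by move=> oU; apply: (Ck_linear (l := snd)) => // z; apply: cvg_snd. Qed.

Lemma row_mx_sum m n (a : 'rV[R]_m) (b : 'rV[R]_n) :
  row_mx a b = a *m row_mx 1%:M 0 + b *m row_mx 0 1%:M.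
Proof. by rewrite !mul_mx_row !mulmx1 !mulmx0 add_row_mx addr0 add0r. Qed.

Lemma row_mx_split m n (a : 'rV[R]_m) (b : 'rV[R]_n) :
  row_mx a b = row_mx a 0 + row_mx 0 b.
Proof. by rewrite add_row_mx addr0 add0r. Qed.

Lemma Ck_row_mx V k m n (U : set V) (f : V -> 'rV[R]_m) (g : V -> 'rV[R]_n) :
  open U -> Ck k U f -> Ck k U g -> Ck k U (fun x => row_mx (f x) (g x)).
Proof.
move=> oU cf cg.
apply: (@Ck_ext _ _ _ _ _ (fun x => mulmxr (row_mx 1%:M 0) (f x) +
    mulmxr (row_mx 0 1%:M) (g x))) => //.
  by move=> x _; rewrite /= [RHS]row_mx_sum.
by apply: CkD => //; apply: Ck_linear => //; exact: rV_linear_continuous.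
Qed.

Lemma diff_affine m n (A : 'M[R]_(m, n)) c a u :
  'd (fun w : 'rV[R]_m => w *m A + c) a u = u *m A.
Proof.
pose l : {linear 'rV[R]_m -> 'rV[R]_n} := mulmxr A.
have cl : continuous l by exact: rV_linear_continuous.
have dA : differentiable l a by exact: linear_differentiable.
rewrite (_ : (fun _ => _) = (l : 'rV[R]_m -> _) + cst c); last exact/funext.
have dl : is_diff a l l by apply: DiffDef dA _; exact: diff_lin.
set f := _ + cst c.
have -> : ('d f a : _ -> _) = (l : 'rV[R]_m -> _) + 0.
  by rewrite /f; exact: diff_val.
by rewrite fctE /= addr0.
Qed.

Lemma continuous_open_preimage n m (U : set 'rV[R]_n) (V : set 'rV[R]_m)
    (f : 'rV[R]_n -> 'rV[R]_m) :
  open U -> Ck 0 U f -> open V -> open (U `&` f @^-1` V).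
Proof.
move=> oU cf oV; rewrite openE => x [Ux Vx]; apply: filterI.
  exact: open_nbhs_nbhs.
by apply: (cf x Ux); apply: open_nbhs_nbhs.
Qed.
End Calculus.

(** * Tangent vectors along plots *)

Section TangentVectors.
Context {R : realType} {X : Type} {D : diffeology R X}.

(** Retraction of the inclusion of the fibre over [x], with the junk value 0
    outside that fibre; it turns equations between points of the bundle into
    equations in a vector space, without transport along equalities of base
    points. *)
Definition fiber_at x (z : tbundle D) : tangent D x :=
  if pselect (bproj z = x) is left e then
    eq_rect (bproj z) (tangent D) (projT2 z) x e
  else 0.

Lemma in_fiberK x : cancel (@in_fiber _ _ D x) (fiber_at x).
Proof.
move=> t; rewrite /fiber_at /=; case: pselect => [e|/(_ erefl)//].
by rewrite (Prop_irrelevance e erefl).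
Qed.

Lemma fiber_atK x z : bproj z = x -> in_fiber (fiber_at x z) = z.
Proof. by case: z => y t /= yx; subst y; rewrite -/(in_fiber t) in_fiberK. Qed.

(** [Tplot_class] for a base point that is only provably equal to the value of
    the plot. *)
Lemma Tplot_class_at n (U : set 'rV[R]_n) p (pU : plot D U p) x u v
    (Uu : U u) (W : set 'rV[R]_n) (cW : connected W) (W0 : W 0)
    (pW : plot D W (fun w => p (u + w))) (e : p (u + 0) = x) :
  Tplot pU (u, v) = in_fiber (tvec (PPlot cW W0 pW e) v).
Proof.
have ux : p u = x by rewrite -e addr0.
by destruct ux; exact: (@Tplot_class _ _ D n U p pU u v Uu W cW W0 pW e).
Qed.

Lemma Tplot_tvec x (p : pplot D x) u :
  Tplot (pfun_plot p) (0, u) = in_fiber (tvec p u).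
Proof.
have p0 : plot D (pdom p) (fun w => pfun p (0 + w)).
  by apply: plot_ext (pfun_plot p) => w _; rewrite add0r.
have e : pfun p (0 + 0) = x by rewrite addr0 pfun0.
rewrite (Tplot_class_at _ _ (pdom0 p) (pdom_connected p) (pdom0 p) p0 e).
congr in_fiber; set q := PPlot _ _ _ _.
have m : @germ_mor _ _ _ _ q p (id : 'rV[R]_(pdim p) -> 'rV[R]_(pdim p)).
  split=> //; exists (pdom p); split=> //; first exact: plot_open (pfun_plot p).
  - exact: pdom0.
  - by move=> k; apply: Ck_id.
  - by move=> w pw; rewrite /= add0r.
have did : 'd (id : 'rV[R]_(pdim p) -> 'rV[R]_(pdim p)) 0 u = u.
  by rewrite (_ : ('d id 0 : _ -> _) = id)//; exact: diff_val.
by have /= := @tvec_germ _ _ _ _ q p id u m; rewrite did => ->.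
Qed.

Lemma diff_recenter n m (g : 'rV[R]_n -> 'rV[R]_m) a u :
  differentiable g a -> 'd (fun w => g (a + w) - g a) 0 u = 'd g a u.
Proof.
move=> dg.
have ds : is_diff (0 : 'rV[R]_n) (cst a + id) (0 + id).
  exact: is_diffD.
have dga : is_diff ((cst a + id) 0) g ('d g a).
  by rewrite !fctE addr0; apply: DiffDef.
have dc := is_diffD (is_diff_comp ds dga) (is_diff_cst (- g a) (0 : 'rV[R]_n)).
set f := fun _ => _.
have df : is_diff 0 f ('d g a : 'rV[R]_n -> 'rV[R]_m).
  apply: is_diff_eq dc _; apply/funext => v.
  by rewrite !fctE /= add0r addr0.
exact: (congr1 (fun h => h u) (@diff_val _ _ _ _ _ _ _ df)).
Qed.

(** The germ relation of the colimit at an arbitrary point: recentring [g] as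
    [w |-> g (a + w) - g a] turns a local factorization of [p] through [q] into
    a morphism of pointed plots. *)
Lemma Tplot_comp n m (U : set 'rV[R]_n) (V : set 'rV[R]_m) p q
    (pU : plot D U p) (qV : plot D V q) (W : set 'rV[R]_n)
    (g : 'rV[R]_n -> 'rV[R]_m) a u :
  open W -> W a -> smooth_on W g ->
  (forall w, W w -> [/\ U w, V (g w) & p w = q (g w)]) ->
  Tplot pU (a, u) = Tplot qV (g a, 'd g a u).
Proof.
move=> oW Wa sg WUV; have [Ua Vga pqa] := WUV a Wa.
set P := shift_pplot pU Ua; set Q := shift_pplot qV Vga.
have e : q (g a + 0) = p a by rewrite addr0.
rewrite [LHS](Tplot_class_at pU u Ua (pdom_connected P) (pdom0 P)
  (pfun_plot P) (pfun0 P)).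
rewrite [RHS](Tplot_class_at qV ('d g a u) Vga (pdom_connected Q) (pdom0 Q)
  (pfun_plot Q) e).
congr in_fiber; set P' := PPlot _ _ _ (pfun0 P); set Q' := PPlot _ _ _ e.
pose f w := g (a + w) - g a.
have m1 : @germ_mor _ _ _ _ P' Q' f.
  split; first by rewrite /f addr0 subrr.
  pose A := [set: 'rV[R]_n] `&` (fun w => a + w) @^-1` W.
  have oA : open A.
    apply: continuous_open_preimage; [exact: openT| |exact: oW].
    apply: CkD; [exact: openT|exact: Ck_cst|exact: Ck_id].
  have sf k : Ck k A f.
    apply: CkD => //; last exact: Ck_cst.
    apply: (Ck_comp (U' := W) oA) => [w []//||]; last exact: sg.
    by apply: CkD => //; [exact: Ck_cst|exact: Ck_id].
  exists ((A `&` f @^-1` pdom Q) `&` pdom P); split.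
  - apply: openI; last exact: plot_open (pfun_plot P).
    by apply: continuous_open_preimage => //; apply: plot_open (pfun_plot Q).
  - split; last exact: pdom0.
    split; first by split; rewrite //= addr0.
    by rewrite /f /= addr0 subrr; apply: (pdom0 Q).
  - by move=> w [].
  - by move=> k; apply: Ck_sub (sf k) => w [[]].
  - move=> w [[[_ Ww] Qw] Pw]; split=> //=.
    by have [_ _ ->] := WUV _ Ww; rewrite /f addrCA subrr addr0.
have da : differentiable g a by have [+ _] := sg 1%N; apply.
have E : 'd (f : 'rV[R]_n -> 'rV[R]_m) 0 u = 'd g a u := diff_recenter u da.
have /= H := @tvec_germ _ _ _ _ P' Q' f u m1.
rewrite E in H.
exact: esym H.
Qed.
End TangentVectors.

Section TangentVectorsAt.
Context {R : realType} {X : Type} {D : diffeology R X}.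

Section Def.
Variables (x : X) (n : nat) (U : set 'rV[R]_n) (p : 'rV[R]_n -> X).
Variables (pU : plot D U p) (a : 'rV[R]_n).

(** With the base point fixed in advance, the value is linear in the direction
    even where [p a] differs from [x], since it is then constantly 0. *)
Definition Tplot_at (u : 'rV[R]_n) : tangent D x :=
  fiber_at x (Tplot pU (a, u)).

Lemma Tplot_at_is_linear : linear Tplot_at.
Proof.
move=> c u v; rewrite /Tplot_at /Tplot /=.
case: (pselect (U a)) => [Ua|nUa]; last first.
  rewrite /fiber_at /=; case: pselect => [pa|_]; last by rewrite scaler0 addr0.
  by destruct pa; rewrite /= scaler0 addr0.
rewrite /fiber_at /=; case: pselect => [pa|_]; last by rewrite scaler0 addr0.
by destruct pa; rewrite /= linearP.
Qed.
HB.instance Definition _ := GRing.isLinear.Build R 'rV[R]_n (tangent D x) *:%R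
  Tplot_at Tplot_at_is_linear.

Lemma Tplot_atK u : p a = x -> in_fiber (Tplot_at u) = Tplot pU (a, u).
Proof. by move=> pa; rewrite fiber_atK. Qed.
End Def.

Lemma Tplot_at_tvec x (p : pplot D x) u :
  Tplot_at x (pfun_plot p) 0 u = tvec p u.
Proof. by rewrite /Tplot_at Tplot_tvec in_fiberK. Qed.

Lemma Tplot_at_comp x n m (U : set 'rV[R]_n) (V : set 'rV[R]_m) p q
    (pU : plot D U p) (qV : plot D V q) (W : set 'rV[R]_n)
    (g : 'rV[R]_n -> 'rV[R]_m) a u :
  open W -> W a -> smooth_on W g ->
  (forall w, W w -> [/\ U w, V (g w) & p w = q (g w)]) ->
  Tplot_at x pU a u = Tplot_at x qV (g a) ('d g a u).
Proof.
move=> oW Wa sg WUV; congr (fiber_at x _).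
exact: Tplot_comp oW Wa sg WUV.
Qed.

(** Affine factorizations suffice for all the partial inclusions and diagonals
    used below, and for them the derivative is explicit. *)
Lemma Tplot_at_affine x n m (U : set 'rV[R]_n) (V : set 'rV[R]_m) p q
    (pU : plot D U p) (qV : plot D V q) (W : set 'rV[R]_n)
    (g : 'rV[R]_n -> 'rV[R]_m) (A : 'M[R]_(n, m)) (c : 'rV[R]_m) a u du :
  (forall w, g w = w *m A + c) -> du = u *m A -> open W -> W a ->
  (forall w, W w -> [/\ U w, V (g w) & p w = q (g w)]) ->
  Tplot_at x pU a u = Tplot_at x qV (g a) du.
Proof.
move=> /funext -> -> oW Wa WUV; rewrite -(diff_affine A c a u).
apply: (Tplot_at_comp x pU qV u oW Wa _ WUV) => k.
apply: CkD => //; last exact: Ck_cst.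
exact: (@rV_linear_Ck _ _ _ _ _ (mulmxr A)).
Qed.

Lemma Tplot_at_cst x n (U : set 'rV[R]_n) p (pU : plot D U p) a u :
  U a -> (forall w, U w -> p w = p a) -> Tplot_at x pU a u = 0.
Proof.
move=> Ua pc.
rewrite (Tplot_at_affine x pU pU (W := U) (g := fun=> a) (A := 0) (c := a)
  (du := 0)) ?linear0//.
- by move=> w; rewrite mulmx0 add0r.
- exact: plot_open pU.
- by move=> w Uw; split=> //; exact: pc.
Qed.
End TangentVectorsAt.

(** * The tangent map of a smooth map *)

Section TangentFunctor.
Context {R : realType} {X Y : Type} {D : diffeology R X} {E : diffeology R Y}.
Variable f : smooth_map D E.

Definition Tmap (z : tbundle D) : tbundle E :=
  in_fiber (tmap f (bproj z) (projT2 z)).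

Lemma Tmap_Tplot n (U : set 'rV[R]_n) p (pU : plot D U p) z :
  Tmap (Tplot pU z) = Tplot (smooth_funP f pU) z.
Proof.
case: z => a u; case: (pselect (U a)) => [Ua|nUa]; last first.
  rewrite /Tplot /Tmap /=; case: pselect => //= _.
  by rewrite linear0.
set P := push_pplot f (shift_pplot pU Ua).
rewrite (Tplot_class (smooth_funP f pU) u Ua (pdom_connected P) (pdom0 P)
  (pfun_plot P) (pfun0 P)).
rewrite /Tplot /Tmap /=; case: pselect => // Ua'.
rewrite (Prop_irrelevance Ua' Ua) tmapE; congr in_fiber.
Qed.

Lemma tmap_Tplot_at x n (U : set 'rV[R]_n) p (pU : plot D U p) a u : p a = x ->
  tmap f x (Tplot_at x pU a u) = Tplot_at (f x) (smooth_funP f pU) a u.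
Proof.
move=> pa; rewrite -[LHS]in_fiberK.
by rewrite [RHS]/Tplot_at -Tmap_Tplot -(Tplot_atK pU u pa).
Qed.

Lemma hector_Tmap : smooth (hector_diff D) (hector_diff E) Tmap.
Proof.
move=> n U P [_ /(_ (sub_diff (hector_diff E) Tmap))]; apply.
move=> k W p pW m V g oV sg gW.
apply: plot_ext (hector_contains_Tplots (smooth_funP f pW) oV sg gW) => v Vv.
by rewrite /= Tmap_Tplot.
Qed.

(** The projection to the base of [T X] cannot be read off from the image in
    [T Y], so the diffeology tested against minimality records a point of
    [T X] together with its image. *)
Lemma dvs_Tmap : smooth (dvs_diff D) (dvs_diff E) Tmap.
Proof.
pose F := sub_diff (prod_diff (dvs_diff D) (dvs_diff E)) (fun z => (z, Tmap z)).
have [sp sA sS] := dvs_diff_dvs D; have [_ sA' sS'] := dvs_diff_dvs E.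
suff HF : contains_hector F /\ is_dvs F.
  by move=> n U P [_ /(_ F HF)[]].
split=> [n U P hP|].
  split; first exact: dvs_contains_hector.
  by apply: dvs_contains_hector; apply: hector_Tmap.
split=> [n U P [P1 _]|n U P [[P11 P12] [P21 P22]]|n U P [[P11 P12] P2]].
- exact: (sp _ _ _ P1).
- split; first exact: (sA _ _ P (conj P11 P21)).
  pose g (z : bpair D) : bpair E :=
    existT _ (f (projT1 z)) (tmap f _ (projT2 z).1, tmap f _ (projT2 z).2).
  have := sA' _ U (g \o P) (conj P12 P22).
  apply: plot_ext => v Uv /=.
  by rewrite /badd /Tmap /= linearD.
- split; first exact: (sS _ _ P (conj P11 P2)).
  pose g (z : tbundle D * R) := (Tmap z.1, z.2).
  have := sS' _ U (g \o P) (conj P12 P2).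
  apply: plot_ext => v Uv /=.
  by rewrite /bscale /Tmap /= linearZ.
Qed.
End TangentFunctor.

(** * Plots of diffeological groups and cosets *)

Lemma plot_sub (R : realType) (X : Type) (E : diffeology R X) n
    (U W : set 'rV[R]_n) p :
  plot E U p -> open W -> W `<=` U -> plot E W p.
Proof.
by move=> pU oW WU; apply: (plot_comp (f := id) pU oW) => // k; exact: Ck_id.
Qed.

Section DiffGroup.
Context {R : realType} {G : groupType} {D : diffeology R G}.
Hypothesis hD : is_diff_group D.

Lemma plotM n (U : set 'rV[R]_n) p q : plot D U p -> plot D U q ->
  plot D U (fun w => p w * q w)%g.
Proof.
by move=> pU qU; have [+ _] := hD => /(_ n U (fun w => (p w, q w))); apply.
Qed.

Lemma plotV n (U : set 'rV[R]_n) p : plot D U p ->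
  plot D U (fun w => (p w)^-1)%g.
Proof. by move=> pU; have [_ +] := hD => /(_ n U p); apply. Qed.

Definition box m n (U : set 'rV[R]_m) (V : set 'rV[R]_n) : set 'rV[R]_(m + n) :=
  [set z | U (lsubmx z) /\ V (rsubmx z)].

Definition ext_prod m n (p : 'rV[R]_m -> G) (q : 'rV[R]_n -> G)
  (z : 'rV[R]_(m + n)) : G := (p (lsubmx z) * q (rsubmx z))%g.

Lemma box_row_mx m n (U : set 'rV[R]_m) (V : set 'rV[R]_n) a b :
  U a -> V b -> box U V (row_mx a b).
Proof. by move=> Ua Vb; split; rewrite ?row_mxKl ?row_mxKr. Qed.

Lemma ext_prod_row_mx m n (p : 'rV[R]_m -> G) (q : 'rV[R]_n -> G) a b :
  ext_prod p q (row_mx a b) = (p a * q b)%g.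
Proof. by rewrite /ext_prod row_mxKl row_mxKr. Qed.

Lemma plot_ext_prod m n (U : set 'rV[R]_m) (V : set 'rV[R]_n) p q :
  plot D U p -> plot D V q -> plot D (box U V) (ext_prod p q).
Proof.
move=> pU qV.
have sl k W : Ck k W (lsubmx : 'rV[R]_(m + n) -> 'rV[R]_m).
  exact: rV_linear_Ck.
have sr k W : Ck k W (rsubmx : 'rV[R]_(m + n) -> 'rV[R]_n).
  exact: rV_linear_Ck.
have oB : open (box U V).
  have -> : box U V = ([set: 'rV[R]_(m + n)] `&` lsubmx @^-1` U) `&`
      ([set: 'rV[R]_(m + n)] `&` rsubmx @^-1` V).
    by apply/seteqP; split=> z [] //= [] _ ? [].
  apply: openI; apply: continuous_open_preimage.
  - exact: openT.
  - exact: sl.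
  - exact: plot_open pU.
  - exact: openT.
  - exact: sr.
  - exact: plot_open qV.
apply: plotM.
- by apply: (plot_comp (f := lsubmx) pU oB) => [k|z []]; first exact: sl.
- by apply: (plot_comp (f := rsubmx) qV oB) => [k|z []]; first exact: sr.
Qed.

Section Cosets.
Variable H : groupClosed G.

Lemma to_coset_eq g g' : to_coset H g = to_coset H g' <-> (g^-1 * g' \in H)%g.
Proof.
split=> [[]|gg'].
  move=> /(congr1 (fun A => A g')) => e.
  have : left_coset H g g'.
    by rewrite e; exists 1%g; rewrite ?mulg1//=; exact: gpred1.
  by move=> [h /= hH <-]; rewrite mulKg.
apply: eq_exist; apply/seteqP; split=> _ [h /= hH <-].
  exists ((g^-1 * g')^-1 * h)%g => /=.
    by rewrite gpredMl ?gpredV.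
  by rewrite invgM invgK !mulgA mulgV mul1g.
exists ((g^-1 * g') * h)%g => /=; first by rewrite gpredMl.
by rewrite !mulgA mulgV mul1g.
Qed.
End Cosets.
End DiffGroup.

(** * Spaces where sums of tangent vectors along plots are again such *)

Section SingleVectors.
Context {R : realType} {X : Type}.
Variable D : diffeology R X.

Definition Tplot_form m (W : set 'rV[R]_m) (P : 'rV[R]_m -> tbundle D) :=
  exists n (V : set 'rV[R]_n) p (pV : plot D V p)
    (f : 'rV[R]_m -> 'rV[R]_n * 'rV[R]_n),
  [/\ open W, smooth_on W f, forall w, W w -> V (f w).1 &
      forall w, W w -> P w = Tplot pV (f w)].

Definition local_Tplot m (U : set 'rV[R]_m) (P : 'rV[R]_m -> tbundle D) :=
  forall u, U u -> exists W, [/\ W u, W `<=` U & Tplot_form W P].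

Lemma local_Tplot_open m (U : set 'rV[R]_m) P : local_Tplot U P -> open U.
Proof.
move=> H; rewrite openE => u /H[W [Wu WU [n [V [p [pV [f [oW _ _ _]]]]]]]].
by apply: (filterS WU); apply: open_nbhs_nbhs.
Qed.

Lemma local_Tplot_hector m (U : set 'rV[R]_m) P :
  local_Tplot U P -> plot (hector_diff D) U P.
Proof.
move=> H; apply: plot_local; first exact: local_Tplot_open H.
move=> u /H[W [Wu WU [n [V [p [pV [f [oW sf fV Pf]]]]]]]].
exists W; split=> //.
apply: plot_ext (hector_contains_Tplots pV oW sf fV) => w Ww /=.
by rewrite Pf.
Qed.

Lemma bscale_Tplot n (U : set 'rV[R]_n) p (pU : plot D U p) a u s :
  bscale (Tplot pU (a, u), s) = Tplot pU (a, s *: u).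
Proof.
rewrite /bscale /Tplot /=; case: pselect => Ua; congr in_fiber.
  by rewrite linearZ.
by rewrite scaler0.
Qed.

(** The property that collapses the two diffeologies on the tangent bundle into
    one; the sums are taken over a varying base point [b w]. *)
Definition Tplots_addable := forall m (U : set 'rV[R]_m) (b : 'rV[R]_m -> X)
    (v1 v2 : forall w, tangent D (b w)),
  local_Tplot U (fun w => in_fiber (v1 w)) ->
  local_Tplot U (fun w => in_fiber (v2 w)) ->
  local_Tplot U (fun w => in_fiber (v1 w + v2 w)).

Hypothesis addD : Tplots_addable.

(** Every tangent vector is a finite sum of vectors of pointed plots, hence by
    additivity a single such vector. In a general space
    constant families need not be of the form [Tp o f]. *)
Lemma local_Tplot_cst m (U : set 'rV[R]_m) z : open U ->
  local_Tplot U (fun=> z).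
Proof.
case: z => x t oU; rewrite -/(in_fiber t) -(tclass_repr t) tclass_sum.
elim: (repr t) => [|[p u] s IH].
  rewrite big_nil => a Ua; exists U; split=> //.
  have c : plot D [set: 'rV[R]_0] (fun=> x) by apply: plot_cst; exact: openT.
  exists 0, setT, (fun=> x), c, (fun=> (0, 0)); split=> //.
    by move=> k; exact: Ck_cst.
  by move=> w _; rewrite -(Tplot_atK (x := x))// linear0.
rewrite big_cons /=; apply: addD IH => a Ua; exists U; split=> //.
exists _, _, _, (pfun_plot p), (fun=> (0, u)); split=> //.
- by move=> k; exact: Ck_cst.
- by move=> w _; exact: pdom0.
- by move=> w _; rewrite Tplot_tvec.
Qed.

Let loc_ext m (U : set 'rV[R]_m) P P' : (forall u, U u -> P u = P' u) ->
  local_Tplot U P -> local_Tplot U P'.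
Proof.
move=> PP H u /H[W [Wu WU [n [V [p [pV [f [oW sf fV Pf]]]]]]]].
exists W; split=> //; exists n, V, p, pV, f; split=> // w Ww.
by rewrite -Pf// PP//; apply: WU.
Qed.

Let loc_comp k m (U : set 'rV[R]_m) (V : set 'rV[R]_k) P
    (g : 'rV[R]_k -> 'rV[R]_m) : local_Tplot U P -> open V ->
  smooth_on V g -> (forall v, V v -> U (g v)) -> local_Tplot V (P \o g).
Proof.
move=> H oV sg gU a Va.
have [W [Wa WU [n [V' [p [pV [f [oW sf fV Pf]]]]]]]] := H _ (gU a Va).
exists (V `&` g @^-1` W); split=> //.
have oVW : open (V `&` g @^-1` W).
  by apply: continuous_open_preimage => //; exact: (sg 0%N).
exists n, V', p, pV, (f \o g); split=> //.
- move=> j; apply: Ck_comp (sf j) => //; first by move=> x [].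
  by apply: Ck_sub (sg j) => x [].
- by move=> w [_ /fV].
- by move=> w [_ /Pf].
Qed.

Let loc_local m (U : set 'rV[R]_m) P : open U ->
  (forall u, U u -> exists W, [/\ W u, W `<=` U & local_Tplot W P]) ->
  local_Tplot U P.
Proof.
move=> _ H u /H[W [Wu WU /(_ u Wu)[W' [Wu' WW' F]]]].
by exists W'; split=> // w /WW' /WU.
Qed.

Let local_Tplot_diff : diffeology R (tbundle D) :=
  Diffeology local_Tplot_open loc_ext local_Tplot_cst loc_comp loc_local.

(** As constants are covered, the local [Tp o f] form a diffeology, so
    minimality of Hector's diffeology applies. *)
Lemma hector_local_Tplot m (U : set 'rV[R]_m) P :
  plot (hector_diff D) U P -> local_Tplot U P.
Proof.
move=> [_ /(_ local_Tplot_diff)]; apply=> n V p pV k W f oW sf fV w Ww.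
by exists W; split=> //; exists n, V, p, pV, f.
Qed.

Lemma hector_is_dvs : is_dvs (hector_diff D).
Proof.
split=> [m U P hP|m U P [h1 h2]|m U P [h1 [oU sP]]].
- by have [+ _ _] := dvs_diff_dvs D; apply; apply: dvs_contains_hector.
- apply: local_Tplot_hector.
  exact: (addD (b := fun w => projT1 (P w)) (hector_local_Tplot h1)
    (hector_local_Tplot h2)).
- apply: local_Tplot_hector => u Uu.
  have [W [Wu WU [n [V [p [pV [f [oW sf fV Pf]]]]]]]] :=
    hector_local_Tplot h1 Uu.
  exists W; split=> //.
  exists n, V, p, pV, (fun w => ((f w).1, (P w).2 *: (f w).2)); split=> //.
    move=> k; apply: Ck_pair => //; first exact: Ck_fst.
    by apply: CkZ; [exact: oW|exact: Ck_sub (sP k)|exact: Ck_snd].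
  move=> w Ww; rewrite -bscale_Tplot -surjective_pairing -Pf//=.
Qed.

Lemma plot_dvs_hector m (U : set 'rV[R]_m) P :
  plot (dvs_diff D) U P <-> plot (hector_diff D) U P.
Proof.
split=> [[_ /(_ (hector_diff D))]|]; last exact: dvs_contains_hector.
by apply; split; [move=> ? ? ?|exact: hector_is_dvs].
Qed.

Lemma hector_eq_dvs : hector_diff D = dvs_diff D.
Proof.
have := plot_dvs_hector.
case: (hector_diff D) (dvs_diff D) => [P1 ? ? ? ? ?] [P2 ? ? ? ? ?] /= e.
have {}e : P1 = P2.
  do 3![apply: functional_extensionality_dep => ?].
  by apply/propext; split=> /e.
by subst P2; congr Diffeology; exact: Prop_irrelevance.
Qed.
End SingleVectors.

(** * Addition of tangent vectors of a coset space *)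

Section CosetTangent.
Context {R : realType} {G : groupType} {D : diffeology R G}.
Hypothesis hD : is_diff_group D.
Variable H : groupClosed G.
Notation Q := (coset_diff D H).
Notation proj := (coset_proj D H).

Lemma coset_lift n (V : set 'rV[R]_n) q a : plot Q V q -> V a ->
  exists N p, [/\ N a, N `<=` V, open N, plot D N p &
    forall x, N x -> q x = to_coset H (p x)].
Proof.
move=> /[apply] -[N [p [Na NV pN qp]]]; exists N, p; split=> //.
exact: plot_open pN.
Qed.

(** The middle and right factors multiply to an element of [H]. *)
Lemma to_coset_mulVr g1 g2 g3 : to_coset H g2 = to_coset H g3 ->
  to_coset H (g1 * g2^-1 * g3)%g = to_coset H g1.
Proof.
move=> /to_coset_eq gg; apply/esym/to_coset_eq.
by rewrite !mulgA mulVg mul1g.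
Qed.

(** In the plot [p1 x * (p1 y)^-1 * p2 z] the first two factors cancel at the
    base point [x = y], which leaves [p2 z], in the coset of both base points;
    [y] receives direction zero and so contributes nothing. *)
Lemma coset_Tplots_addable : Tplots_addable Q.
Proof.
move=> m U b v1 v2 H1 H2 u Uu.
have [W1 [Wu1 WU1 [n1 [V1 [q1 [qV1 [f1 [oW1 sf1 fV1 E1]]]]]]]] := H1 u Uu.
have [W2 [Wu2 WU2 [n2 [V2 [q2 [qV2 [f2 [oW2 sf2 fV2 E2]]]]]]]] := H2 u Uu.
have [N1 [p1 [Na1 NV1 oN1 pN1 qp1]]] := coset_lift qV1 (fV1 u Wu1).
have [N2 [p2 [Na2 NV2 oN2 pN2 qp2]]] := coset_lift qV2 (fV2 u Wu2).
pose r := plot_ext_prod hD (plot_ext_prod hD pN1 (plotV hD pN1)) pN2.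
pose F w := (row_mx (row_mx (f1 w).1 (f1 w).1) (f2 w).1,
             row_mx (row_mx (f1 w).2 (0 : 'rV[R]_n1)) (f2 w).2).
pose W := (W1 `&` (fun w => (f1 w).1) @^-1` N1) `&`
          (W2 `&` (fun w => (f2 w).1) @^-1` N2).
have oW : open W.
  apply: openI.
    by apply: (continuous_open_preimage oW1 _ oN1); exact: Ck_fst oW1 (sf1 0%N).
  by apply: (continuous_open_preimage oW2 _ oN2); exact: Ck_fst oW2 (sf2 0%N).
have WW1 : W `<=` W1 by move=> w [[]].
have WW2 : W `<=` W2 by move=> w [_ []].
exists W; split=> //; first by move=> w /WW1 /WU1.
eexists _, _, _, (smooth_funP proj r), F; split=> //.
- move=> k.
  have c1 : Ck k W f1 by apply: Ck_sub (sf1 k).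
  have c2 : Ck k W f2 by apply: Ck_sub (sf2 k).
  have c11 : Ck k W (fun w => (f1 w).1) by exact: Ck_fst.
  have c12 : Ck k W (fun w => (f1 w).2) by exact: Ck_snd.
  have c21 : Ck k W (fun w => (f2 w).1) by exact: Ck_fst.
  have c22 : Ck k W (fun w => (f2 w).2) by exact: Ck_snd.
  have c0 : Ck k W (fun=> 0 : 'rV[R]_n1) by exact: Ck_cst.
  exact: Ck_pair oW (Ck_row_mx oW (Ck_row_mx oW c11 c11) c21)
    (Ck_row_mx oW (Ck_row_mx oW c12 c0) c22).
- by move=> w [[_ ?] [_ ?]] /=; do 2?apply: box_row_mx.
move=> w [[Ww1 Nw1] [Ww2 Nw2]].
move: (E1 w Ww1) (E2 w Ww2) Nw1 Nw2; rewrite /F /=.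
case: (f1 w) (f2 w) => [x a] [z c] /= e1 e2 Nx Nz.
have bx : q1 x = b w by have := congr1 (@bproj _ _ _) e1.
have bz : q2 z = b w by have := congr1 (@bproj _ _ _) e2.
have xz : to_coset H (p1 x) = to_coset H (p2 z) by rewrite -qp1// -qp2// bx bz.
rewrite -(Tplot_atK (x := b w)); last first.
  by rewrite /= !ext_prod_row_mx to_coset_mulVr// -qp1.
congr in_fiber.
(* Leibniz rule: one summand for moving x, one for moving z. *)
rewrite (row_mx_split _ c) linearD -[v1 w]in_fiberK e1 -[v2 w]in_fiberK e2.
congr (_ + _).
  apply: (Tplot_at_affine _ _ _ (W := N1) (g := fun y => row_mx (row_mx y x) z)
    (A := row_mx (row_mx 1%:M 0) 0) (c := row_mx (row_mx 0 x) z)) => //.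
  - move=> y; rewrite !mul_mx_row mulmx1 !mulmx0 !add_row_mx addr0 !add0r //.
  - by rewrite !mul_mx_row mulmx1 !mulmx0.
  - move=> y Ny; split; [exact: NV1|by do 2?apply: box_row_mx|].
    by rewrite /= !ext_prod_row_mx to_coset_mulVr// qp1.
apply: (Tplot_at_affine _ _ _ (W := N2) (g := fun y => row_mx (row_mx x x) y)
    (A := row_mx 0 1%:M) (c := row_mx (row_mx x x) 0)) => //.
- by move=> y; rewrite !mul_mx_row mulmx1 !mulmx0 !add_row_mx addr0 !add0r.
- by rewrite !mul_mx_row mulmx1 !mulmx0.
- move=> y Ny; split; [exact: NV2|by do 2?apply: box_row_mx|].
  by rewrite /= !ext_prod_row_mx mulgV mul1g qp2.
Qed.

End CosetTangent.

(** * The projection on tangent spaces is a subduction *)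

Lemma subduction_of_lifts (R : realType) X Y (D : diffeology R X)
    (E : diffeology R Y) (f : X -> Y) : smooth D E f ->
  (forall n (U : set 'rV[R]_n) p, plot E U p -> locally_lifts D f U p) ->
  subduction D E f.
Proof.
move=> sf lift; split=> // [y|n U p].
  (* Surjectivity is the lifting property for a constant plot. *)
  have c : plot E [set: 'rV[R]_0] (fun=> y) by apply: plot_cst; exact: openT.
  have [W [q [W0 _ _ /(_ 0 W0) ->]]] := lift _ _ _ c 0 I.
  by exists (q 0).
split=> [/lift//|H]; apply: plot_local => [|u /H[W [q [Wu WU qW pq]]]].
  rewrite openE => u /H[W [q [Wu WU /plot_open oW _]]].
  by apply: (filterS WU); apply: open_nbhs_nbhs.
exists W; split=> //; apply: plot_ext (sf _ _ _ qW) => w Ww.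
by rewrite pq.
Qed.

Section CosetSubduction.
Context {R : realType} {G : groupType} {D : diffeology R G}.
Hypothesis hD : is_diff_group D.
Variable H : groupClosed G.
Notation Q := (coset_diff D H).
Notation proj := (coset_proj D H).

(** Over [eH] the values [p x] of a lift lie in [H], so right multiplication by
    [(p x)^-1] moves the vector to [e] without changing its image. The point
    [x] varies with the parameter, hence the two-variable plot. *)
Lemma hector_fiber_lift m (U : set 'rV[R]_m)
    (P : 'rV[R]_m -> tangent Q (proj 1%g)) :
  plot (fiber_diff (hector_diff Q) (proj 1%g)) U P ->
  locally_lifts (fiber_diff (hector_diff D) 1%g) (tmap proj 1%g) U P.
Proof.
move=> hP u Uu.
have [W0 [Wu0 WU0 [n [V [q [qV [f [oW0 sf fV E]]]]]]]] :=
  hector_local_Tplot (@coset_Tplots_addable _ _ _ hD H) hP Uu.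
have [N [p [Na NV oN pN qp]]] := coset_lift qV (fV u Wu0).
pose r := plot_ext_prod hD pN (plotV hD pN).
pose W := W0 `&` (fun w => (f w).1) @^-1` N.
have oW : open W.
  by apply: (continuous_open_preimage oW0 _ oN); exact: Ck_fst oW0 (sf 0%N).
pose F w := (row_mx (f w).1 (f w).1, row_mx (f w).2 (0 : 'rV[R]_n)).
have sF : smooth_on W F.
  move=> k; have cf : Ck k W f by apply: Ck_sub (sf k) => w [].
  have c1 : Ck k W (fun w => (f w).1) by exact: Ck_fst.
  have c2 : Ck k W (fun w => (f w).2) by exact: Ck_snd.
  have c0 : Ck k W (fun=> 0 : 'rV[R]_n) by exact: Ck_cst.
  exact: Ck_pair oW (Ck_row_mx oW c1 c1) (Ck_row_mx oW c2 c0).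
have FN w : W w -> box N N (F w).1 by move=> [_ ?]; exact: box_row_mx.
have F1 w : ext_prod p (fun w => (p w)^-1)%g (F w).1 = 1%g.
  by rewrite ext_prod_row_mx mulgV.
exists W, (fun w => Tplot_at 1%g r (F w).1 (F w).2); split=> //.
- by move=> w [/WU0].
- apply: plot_ext (hector_contains_Tplots r oW sF FN) => w Ww.
  exact: esym (Tplot_atK r _ (F1 w)).
move=> w [Ww0 Nw]; rewrite (tmap_Tplot_at _ _ _ (F1 w)) -[P w]in_fiberK.
have qx : to_coset H 1%g = q (f w).1 := congr1 (@bproj _ _ _) (E w Ww0).
move: (E w Ww0) Nw qx => /= ->; rewrite /F; case: (f w) => x a /= Nx qx.
apply: (Tplot_at_affine _ _ _ (W := N) (g := fun y => row_mx y x)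
    (A := row_mx 1%:M 0) (c := row_mx 0 x)) => //.
- by move=> y; rewrite !mul_mx_row mulmx1 !mulmx0 !add_row_mx addr0 !add0r.
- by rewrite !mul_mx_row mulmx1 !mulmx0.
- move=> y Ny; split; [exact: NV|by apply: box_row_mx|].
  rewrite /= ext_prod_row_mx -[(_ * _)%g]mulg1 to_coset_mulVr ?qp//.
  by rewrite -qp.
Qed.

Lemma hector_subduction : subduction (fiber_diff (hector_diff D) 1%g)
  (fiber_diff (hector_diff Q) (proj 1%g)) (tmap proj 1%g).
Proof.
apply: subduction_of_lifts => [n U P|]; last exact: hector_fiber_lift.
exact: hector_Tmap.
Qed.

Lemma dvs_subduction : subduction (fiber_diff (dvs_diff D) 1%g)
  (fiber_diff (dvs_diff Q) (proj 1%g)) (tmap proj 1%g).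
Proof.
apply: subduction_of_lifts => [n U P|n U P]; first exact: dvs_Tmap.
rewrite -(hector_eq_dvs (@coset_Tplots_addable _ _ _ hD H)).
move=> /hector_fiber_lift lP u /lP[W [P' [Wu WU P'W e]]].
by exists W, P'; split=> //; apply: dvs_contains_hector.
Qed.
End CosetSubduction.

(** * Exactness *)

Section CosetExactness.
Context {R : realType} {G : groupType} {D : diffeology R G}.
Hypothesis hD : is_diff_group D.
Variable H : groupClosed G.
Notation Q := (coset_diff D H).
Notation proj := (coset_proj D H).
Notation iota := (subgroup_incl D H).
Notation eH := (subgroup1 H).

(** Plots of [H] become constant in [G/H]. *)
Lemma tmap_proj_iota t : tmap proj 1%g (tmap iota eH t) = 0.
Proof.
rewrite -(tclass_repr t) tclass_sum !linear_sum /=.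
rewrite big1 // => -[p u] _ /=.
rewrite !tmapE -Tplot_at_tvec Tplot_at_cst//; first exact: pdom0.
move=> w pw /=; apply/to_coset_eq.
case: (pfun p w) (pfun p 0) => [g gH] [g' gH'] /=.
by rewrite gpredM ?gpredV.
Qed.

(** Writing [p = p' * h] with [h] a plot of [H], the Leibniz rule along the
    diagonal gives [p_*(u) = p'_*(u) + h_*(u)]. *)
Lemma lifts_differ n (N N' : set 'rV[R]_n) p p' (pN : plot D N p)
    (pN' : plot D N' p') (W : set 'rV[R]_n) u :
  open W -> W 0 -> p 0 = 1%g -> p' 0 = 1%g ->
  (forall w, W w -> [/\ N w, N' w & to_coset H (p w) = to_coset H (p' w)]) ->
  exists t, tmap iota eH t = Tplot_at 1%g pN 0 u - Tplot_at 1%g pN' 0 u.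
Proof.
move=> oW W0 p0 p'0 pp'.
pose h w : subgroup H := if pselect ((p' w)^-1 * p w \in H)%g is left hw
  then exist (fun x => x \in H) _ hw else eH.
have hE w : W w -> sval (h w) = ((p' w)^-1 * p w)%g.
  move=> Ww; rewrite /h; case: pselect => // -[].
  by have [_ _ /esym/to_coset_eq] := pp' w Ww.
have hW : plot (subgroup_diff D H) W h.
  apply: (@plot_ext _ _ D _ _ (fun w => (p' w)^-1 * p w)%g) => [w Ww|].
    by rewrite /= hE.
  by apply: plotM => //; [apply: plotV => //; apply: plot_sub pN' _ _|
    apply: plot_sub pN _ _] => // w /pp'[].
have h0 : sval (h 0) = 1%g by rewrite hE// p0 p'0 mulg1 invg1.
exists (Tplot_at eH hW 0 u).
rewrite tmap_Tplot_at; last first.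
  by case: (h 0) h0 => g gH /= g1; apply: eq_exist.
pose hG := smooth_funP iota hW; pose r := plot_ext_prod hD pN' hG.
have [_ N'0 _] := pp' 0 W0.
(* Near 0, the plot p is the diagonal restriction of the external product r. *)
have -> : Tplot_at 1%g pN 0 u = Tplot_at 1%g r (row_mx 0 0) (row_mx u u).
  apply: (Tplot_at_affine _ _ _ (W := W) (g := fun w => row_mx w w)
    (A := row_mx 1%:M 1%:M) (c := 0)) => //.
  - by move=> w; rewrite mul_mx_row mulmx1 addr0.
  - by rewrite mul_mx_row mulmx1.
  - move=> w Ww; have [Nw N'w _] := pp' w Ww; split=> //.
      exact: box_row_mx.
    by rewrite ext_prod_row_mx /= hE// mulgA mulgV mul1g.
rewrite (row_mx_split u u) linearD addrAC -[LHS]add0r; congr (_ + _).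
  apply/esym/eqP; rewrite subr_eq0; apply/eqP/esym.
  apply: (Tplot_at_affine _ _ _ (W := N') (g := fun w => row_mx w 0)
    (A := row_mx 1%:M 0) (c := 0)) => //.
  - by move=> w; rewrite mul_mx_row mulmx1 mulmx0 addr0.
  - by rewrite mul_mx_row mulmx1 mulmx0.
  - exact: plot_open pN'.
  - move=> w N'w; split=> //; first exact: box_row_mx.
    by rewrite ext_prod_row_mx /= h0 mulg1.
apply: (Tplot_at_affine _ _ _ (W := W) (g := fun w => row_mx 0 w)
  (A := row_mx 0 1%:M) (c := 0)) => //.
- by move=> w; rewrite mul_mx_row mulmx1 mulmx0 addr0.
- by rewrite mul_mx_row mulmx1 mulmx0.
- move=> w Ww; split=> //; first exact: box_row_mx.
  by rewrite ext_prod_row_mx /= p'0 mul1g.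
Qed.

(** Lifts keep the parameter space of the plot that they lift, so that a vector
    of the latter can be fed to its lift. *)
Definition is_pointed_lift (q : pplot Q (proj 1%g))
    (Np : set 'rV[R]_(pdim q) * ('rV[R]_(pdim q) -> G)) :=
  [/\ plot D Np.1 Np.2, Np.1 0, Np.1 `<=` pdom q, Np.2 0 = 1%g &
    forall w, Np.1 w -> pfun q w = to_coset H (Np.2 w)].

Lemma pointed_lift_exists q : exists Np, @is_pointed_lift q Np.
Proof.
have [N [p [N0 NV oN pN qp]]] := coset_lift (pfun_plot q) (pdom0 q).
exists (N, fun w => p w * (p 0)^-1)%g; split=> //=.
- by apply: plotM => //; apply: plot_cst.
- by rewrite mulgV.
- move=> w Nw; rewrite -[(_ * _)%g]mulg1 to_coset_mulVr ?qp//.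
  by rewrite -qp// pfun0.
Qed.

Let lift q := sval (cid (pointed_lift_exists q)).
Let liftP q : is_pointed_lift (lift q).
Proof. exact: svalP. Qed.
Let lift_plot q : plot D (lift q).1 (lift q).2.
Proof. by have [] := liftP q. Qed.

(** A preimage under [pi_*] of the class of [s]; it depends on the formal sum,
    and on its class only modulo the image of [iota_*]. *)
Definition lift_sum (s : formal_sum Q (proj 1%g)) : tangent D 1%g :=
  \sum_(e <- s) Tplot_at 1%g (lift_plot (tag e)) 0 (tagged e).

Let im v := exists t, tmap iota eH t = v.

Let imD v w : im v -> im w -> im (v + w).
Proof. by move=> [t <-] [t' <-]; exists (t + t'); rewrite linearD. Qed.
Let im0 : im 0.
Proof. by exists 0; rewrite linear0. Qed.

(** Only the germ relation has content: the chosen lift of [p] and the chosen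
    lift of [q] composed with [f] are two lifts of one plot. *)
Lemma lift_sum_colim_eq s s' : colim_eq s s' -> im (lift_sum s - lift_sum s').
Proof.
rewrite /lift_sum; elim=> {s s'}.
- by move=> s; rewrite subrr; exact: im0.
- by move=> s s' _ [t tE]; exists (- t); rewrite linearN /= tE opprB.
- move=> s t r _ st _ tr; set B := \sum_(e <- t) _ in st tr.
  by rewrite -[X in X - _](subrK B) -addrA; apply: imD.
- move=> s s' t t' _ ss _ tt; rewrite !big_cat /= opprD addrACA.
  exact: imD.
- by move=> s t; rewrite !big_cat /= addrC subrr; exact: im0.
- by move=> p; rewrite big_seq1 big_nil /= linear0 subrr; exact: im0.
- move=> p u v; rewrite !big_cons !big_nil /= !addr0 linearD subrr.
  exact: im0.
move=> p q f u [f0 [W [oW W0 Wp sf fq]]]; rewrite !big_seq1 /=.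
have [pL p0 pd p1 pE] := liftP p; have [qL q0 qd q1 qE] := liftP q.
pose W' := W `&` f @^-1` (lift q).1.
have oW' : open W'.
  by apply: (continuous_open_preimage oW (sf 0%N)); exact: plot_open qL.
have W'0 : W' 0 by split=> //=; rewrite f0.
have sf' : smooth_on W' f by move=> k; apply: Ck_sub (sf k) => w [].
have qf : plot D W' ((lift q).2 \o f).
  by apply: plot_comp qL oW' sf' _ => w [].
have := Tplot_at_comp 1%g qf (lift_plot q) u oW' W'0 sf' _.
rewrite f0 => <-; last by move=> w W'w; split=> //; case: W'w.
apply: (lifts_differ _ _ (W := W' `&` (lift p).1)) => //.
- by apply: openI => //; exact: plot_open pL.
- by rewrite /= f0.
- move=> w [[Ww qw] pw]; split=> //; rewrite -pE// /= -qE//.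
  by have [_ ->] := fq w Ww.
Qed.

Lemma coset_exact : exact_at (tmap iota eH) (tmap proj 1%g).
Proof.
move=> v; split=> [v0|[t <-]]; last exact: tmap_proj_iota.
pose push (e : {p : pplot D 1%g & 'rV[R]_(pdim p)}) :=
  fterm (p := push_pplot proj (tag e)) (tagged e).
have pv : colim_eq (map push (repr v)) [::].
  apply/tclassP; rewrite -[RHS]v0 -[v in RHS](tclass_repr v) !tclass_sum.
  rewrite linear_sum big_map /=; apply: eq_bigr => e _.
  by rewrite tmapE.
have := lift_sum_colim_eq pv; rewrite /lift_sum big_nil subr0 big_map => Iv.
rewrite -[v](subrK (\sum_(e <- repr v)
  Tplot_at 1%g (lift_plot (tag (push e))) 0 (tagged (push e)))).
apply: imD Iv.
have vE : v = \sum_(e <- repr v) tvec (tag e) (tagged e).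
  by rewrite -tclass_sum tclass_repr.
rewrite {1}vE -sumrB.
elim/big_ind: _ => [||[p u] _]; [exact: im0|exact: imD|].
rewrite -Tplot_at_tvec /=.
have [qL q0 qd q1 qE] := liftP (push_pplot proj p).
apply: (lifts_differ _ _ (W := (lift (push_pplot proj p)).1)) => //.
- exact: plot_open qL.
- exact: pfun0.
- by move=> w qw; split=> //; [exact: qd|rewrite -qE].
Qed.
End CosetExactness.

(** * The tangent sequence of a subgroup *)

Theorem corollary3p4 (R : realType) (G : groupType) (D : diffeology R G)
    (hD : is_diff_group D) (H : groupClosed G) :
  let e : G := 1%g in
  let eH : subgroup H := subgroup1 H in
  let iota := subgroup_incl D H in
  let proj := coset_proj D H in
  let Q := coset_diff D H in
  [/\ exact_at (tmap iota eH) (tmap proj e),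
    (forall w : tangent Q (proj e), exists v, tmap proj e v = w),
    fiber_diff (hector_diff Q) (proj e) = fiber_diff (dvs_diff Q) (proj e),
    subduction (fiber_diff (hector_diff D) e)
      (fiber_diff (hector_diff Q) (proj e)) (tmap proj e)
  & subduction (fiber_diff (dvs_diff D) e)
      (fiber_diff (dvs_diff Q) (proj e)) (tmap proj e)].
Proof.
move=> e eH iota proj Q.
have [_ surj _] := @hector_subduction _ _ _ hD H.
split.
- exact: coset_exact.
- exact: surj.
- by rewrite (hector_eq_dvs (@coset_Tplots_addable _ _ _ hD H)).
- exact: hector_subduction.
- exact: dvs_subduction.
Qed.
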